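(* Let $\gamma>0$ and let $F=G$ be the generalized Gaussian distribution with parameter $\gamma$, i.e. with density $f(x)\propto\exp(-|x|^\gamma/\gamma)$, $x\in\mathbb{R}$. Let $\varepsilon_n=n^{-\beta}$ with $\beta\in(0,1)$ fixed. Then the CUSUM sign test (the test based on the statistic $M$) achieves the detection boundary, except perhaps in the dense regime when $\gamma<1/2$. That is: (1) (Sparse regime, any $\gamma>0$.) Suppose $1/2<\beta<1$ and $\mu_n=(\gamma r\log n)^{1/\gamma}$ with $r\in(0,1)$ fixed. If $r>\rho^*_\gamma(\beta)$, then the CUSUM sign test is asymptotically powerful. Here, for $\gamma\le 1$, $\rho_\gamma^*(\beta)=2(\beta-1/2)$, and for $\gamma>1$, $$\rho_\gamma^*(\beta)=\begin{cases}(2^{1/(\gamma-1)}-1)^{\gamma-1}(\beta-1/2), & 1/2<\beta<1-2^{-\gamma/(\gamma-1)},\\ (1-(1-\beta)^{1/\gamma})^\gamma, & 1-2^{-\gamma/(\gamma-1)}<\beta<1.\end{cases}$$ (2) (Dense regime, $\gamma\ge 1/2$.) Suppose $0<\beta<1/2$ and $\mu_n=n^{s-1/2}$ with $s\in(0,1/2)$ fixed. If $s>\beta$, then the CUSUM sign test is asymptotically powerful.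
   Context: Testing problem: for each $n$ one observes $X_1,\dots,X_n\in\mathbb{R}$ and tests $H_0^n$: $X_1,\dots,X_n$ are i.i.d. with distribution function $F(x)$, versus $H_1^n$: $X_1,\dots,X_n$ are i.i.d. with distribution function $(1-\varepsilon_n)F(x)+\varepsilon_n G(x-\mu_n)$. Limits are as $n\to\infty$. CUSUM sign test: order the observations so that $|X_{(1)}|>\cdots>|X_{(n)}|$ (almost surely there are no ties), put $\xi_{(i)}=\mathrm{sign}(X_{(i)})\in\{-1,1\}$ and $S_k=\sum_{i=1}^k\xi_{(i)}$. The test rejects for large values of $M=\max_{k=1,\dots,n}S_k/\sqrt{k}$. A test based on a statistic $S$ is asymptotically powerful if the total variation distance between the distribution of $S$ under $H_0^n$ and its distribution under $H_1^n$ tends to its maximal value, which is $2$ with the normalization $\|P-Q\|=2\sup_A|P(A)-Q(A)|$. *)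

(* Defs.v *)
From HB Require Import structures.
From mathcomp Require Import all_boot all_order all_algebra.
From mathcomp Require Import all_classical all_reals all_analysis.

Set Implicit Arguments.
Unset Strict Implicit.
Unset Printing Implicit Defensive.

Import Order.TTheory GRing.Theory Num.Theory.
Import numFieldNormedType.Exports.

Local Open Scope classical_set_scope.
Local Open Scope ring_scope.

Definition mutually_independent (R : realType) (d : measure_display)
    (T : measurableType d) (P : probability T R) (n : nat)
    (X : 'I_n -> {RV P >-> R}) : Prop :=
  forall (J : {set 'I_n}) (B : 'I_n -> set R),
    (forall i, measurable (B i)) ->
    P (\bigcap_(i in [set` J]) (X i @^-1` B i)) =
    (\prod_(i in J) P (X i @^-1` B i))%E.

Definition iid_with_cdf (R : realType) (d : measure_display)
    (T : measurableType d) (P : probability T R) (n : nat)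
    (X : 'I_n -> {RV P >-> R}) (H : R -> R) : Prop :=
  mutually_independent X /\ forall i x, cdf (X i) x = (H x)%:E.

Definition mixture_cdf (R : realType) (F G : R -> R) (eps mu x : R) : R :=
  (1 - eps) * F x + eps * G (x - mu).

(* The law of a statistic g is the pushforward A |-> P (g @^-1` A); it is a
   probability measure as soon as g is measurable. *)
Definition tv_dist (R : realType) (P Q : set R -> \bar R) : \bar R :=
  (2%:E * ereal_sup [set `|P A - Q A| | A in [set A : set R | measurable A]])%E.

(* The n-th testing problem is realised on arbitrary probability spaces: the
   laws of the statistic depend only on the i.i.d. hypotheses. *)
Definition asymptotically_powerful (R : realType)
    (stat : forall n : nat, ('I_n -> R) -> R)
    (F G : R -> R) (eps mu : nat -> R) : Prop :=
  forall (d0 d1 : nat -> measure_display)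
    (T0 : forall n, measurableType (d0 n))
    (T1 : forall n, measurableType (d1 n))
    (P0 : forall n, probability (T0 n) R)
    (P1 : forall n, probability (T1 n) R)
    (X0 : forall n, 'I_n -> {RV (P0 n) >-> R})
    (X1 : forall n, 'I_n -> {RV (P1 n) >-> R}),
  (forall n, iid_with_cdf (X0 n) F) ->
  (forall n, iid_with_cdf (X1 n) (mixture_cdf F G (eps n) (mu n))) ->
  tv_dist (pushforward (P0 n) (fun w => stat n (fun i => X0 n i w)))
          (pushforward (P1 n) (fun w => stat n (fun i => X1 n i w)))
    @[n --> \oo] --> 2%:E.

(* Observations listed by decreasing absolute value. Ties, and observations
   equal to 0 (whose sign Num.sg is 0 instead of 1 or -1), form a null event
   when the distribution function is continuous. *)
Definition sort_by_abs (R : realType) (n : nat) (x : 'I_n -> R) : seq R :=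
  sort (fun a b : R => `|b| <= `|a|) [seq x i | i <- enum 'I_n].

Definition sign_partial_sum (R : realType) (n : nat) (x : 'I_n -> R)
    (k : nat) : R :=
  \sum_(a <- take k (sort_by_abs x)) Num.sg a.

(* The seed of the maximum is its k = 1 term, so for n >= 1 it adds nothing. *)
Definition cusum_sign (R : realType) (n : nat) (x : 'I_n -> R) : R :=
  \big[Num.max/sign_partial_sum x 1 / Num.sqrt 1%:R]_(1 <= k < n.+1)
    (sign_partial_sum x k / Num.sqrt k%:R).

Definition gen_gauss_kernel (R : realType) (gamma x : R) : R :=
  expR (- (`|x| `^ gamma / gamma)).

Definition gen_gauss_density (R : realType) (gamma x : R) : R :=
  gen_gauss_kernel gamma x /
  \int[@lebesgue_measure R]_y gen_gauss_kernel gamma y.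

Definition gen_gauss_cdf (R : realType) (gamma x : R) : R :=
  \int[@lebesgue_measure R]_(y in `]-oo, x]) gen_gauss_density gamma y.

(* The last two branches agree at their common endpoint
   beta = 1 - 2^(- gamma / (gamma - 1)), so its allocation is immaterial. *)
Definition rho_star (R : realType) (gamma beta : R) : R :=
  if gamma <= 1 then 2 * (beta - 1 / 2)
  else if beta < 1 - 2 `^ (- (gamma / (gamma - 1))) then
    (2 `^ (1 / (gamma - 1)) - 1) `^ (gamma - 1) * (beta - 1 / 2)
  else (1 - (1 - beta) `^ (1 / gamma)) `^ gamma.

(* Main.v *)
Require Import Defs.
From HB Require Import structures.
From mathcomp Require Import all_boot all_order all_algebra.
From mathcomp Require Import all_classical all_reals all_analysis.
From mathcomp Require Import measurable_realfun ring lra.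

(* Choose k to be the number N_t of observations with |X_i| > t. Then S_k is the
   sum of the i.i.d. variables 1(X_i > t) - 1(X_i < -t), so M is at least
   S_(N_t) / sqrt(N_t), and Chernoff bounds give M >= n^c with high probability
   under the alternative as soon as n d^2 / p is a power of n, where
   d = P(X > t) - P(X < -t) and p >= P(|X| > t). Under the null hypothesis the
   signs are independent of the ordering of the absolute values, so S_k is a
   simple random walk and a union bound over k yields
   P(M > u) <= n exp(1/2 - u/2), which vanishes for u a positive power of n.
   In the dense regime t = 0 works; in the sparse regime t is a multiple of
   (gamma log n)^(1/gamma). *)

Set Implicit Arguments.
Unset Strict Implicit.
Unset Printing Implicit Defensive.

Import Order.TTheory GRing.Theory Num.Theory.
Import numFieldNormedType.Exports.

Local Open Scope classical_set_scope.
Local Open Scope ring_scope.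

(** * Chernoff bounds for weighted sums *)

(** The quantity n d^2 / p compares the mean n d of S_(N_t) with the scale sqrt(n p) of its
    denominator. In the sparse regime put y = r^(1/gamma) and t = x (gamma log n)^(1/gamma) with x
    >= y. On the scale of powers of n, d behaves like n^(-beta - (x - y)^gamma) and p like
    n^(-x^gamma) + d. Each part of p has to be beaten, which gives two strict inequalities: 2 (x -
    y)^gamma < x^gamma + 1 - 2 beta and (x - y)^gamma < 1 - beta. Strictness leaves a small power of
    n to spare, and it pays for every loss: constants, a fraction of the tail exponent, the union
    bound. Under the null hypothesis the obstacle is that the ordering of the absolute values
    couples all coordinates, while mutual independence only speaks of products of sets; a pi-system
    argument bridges this. Afterwards only finitely many order and sign patterns matter, so the
    exponential bounds are inequalities between finite sums. *)

Lemma expR_le_quadratic (R : realType) (x : R) :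
  `|x| <= 1 / 2 -> expR x <= 1 + x + 2 * x ^+ 2.
Proof.
rewrite ler_norml => /andP[x1 x2].
have h := expR_ge1Dx (- x).
have e0 := expR_gt0 x.
have : expR x * (1 - x) <= 1.
  by rewrite -[leRHS](expRxMexpNx_1 x) ler_wpM2l // ltW.
move=> h2.
(* The product equals [1 + x^2 (1 - 2 x)]; this is where [x <= 1/2] enters. *)
have h3 : 1 <= (1 + x + 2 * x ^+ 2) * (1 - x) by nra.
have x3 : 0 < 1 - x by lra.
by rewrite -(ler_pM2r x3) (le_trans h2).
Qed.


(** Markov's inequality on a finite product: [bigA_distr_bigA] expands the product of moment
    generating functions over all outcomes, and each outcome kept on the left has
    [exp (sum - a) >= 1]. *)
Lemma chernoff_weighted_sum (R : realType) (I D : finType) (p g : I -> D -> R) (a : R) :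
  (forall i y, 0 <= p i y) ->
  \sum_(s : {ffun I -> D} | a <= \sum_i g i (s i)) \prod_i p i (s i) <=
  expR (- a) * \prod_i \sum_y p i y * expR (g i y).
Proof.
move=> p0; rewrite bigA_distr_bigA /= mulr_sumr.
rewrite [leRHS](bigID (fun s : {ffun I -> D} => a <= \sum_i g i (s i))) /=.
rewrite -[leLHS]addr0; apply: lerD; last first.
  apply: sumr_ge0 => s _; rewrite mulr_ge0 ?expR_ge0 //.
  by apply: prodr_ge0 => i _; rewrite mulr_ge0 ?expR_ge0.
apply: ler_sum => s as_.
rewrite big_split /= -expR_sum mulrCA ler_peMr ?prodr_ge0 //.
by rewrite -expRD -expR0 ler_expR addrC subr_ge0.
Qed.

Lemma preimage_fintype_measurable d (T : measurableType d) (E : finType)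
    (f : T -> E) (A : set E) :
  (forall e, measurable (f @^-1` [set e])) -> measurable (f @^-1` A).
Proof.
move=> mf; rewrite (_ : f @^-1` A = \bigcup_(e in A) (f @^-1` [set e])); last first.
  by apply/seteqP; split => [x Ax|x [e Ae] /= ->//]; exists (f x).
by apply: fin_bigcup_measurable => //; exact: finite_finset.
Qed.

Lemma probability_preimage_fintype d (T : measurableType d) (R : realType)
    (P : probability T R) (E : finType) (f : T -> E) (A : pred E) :
  (forall e, measurable (f @^-1` [set e])) ->
  P (f @^-1` [set` A]) = (\sum_(e | A e) P (f @^-1` [set e]))%E.
Proof.
move=> mf; rewrite (_ : f @^-1` _ = \bigcup_(e in [set` enum A]) (f @^-1` [set e])); last first.
  apply/seteqP; split => [x Ax|x [e Ae] /= ->//]; last by rewrite /= mem_enum in Ae.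
  by exists (f x) => //=; rewrite mem_enum.
rewrite measure_fin_bigcup //; last by move=> e e' _ _ [x []] /= -> ->.
by rewrite -fsbig_seq ?enum_uniq// big_enum.
Qed.

(** * The statistic as a function of ranks and signs *)

Lemma sort_by_absE (R : realType) (n : nat) (x : 'I_n -> R) :
  sort_by_abs x =
  [seq x i | i <- sort (fun i j => `|x j| <= `|x i|) (enum 'I_n)].
Proof. by rewrite /sort_by_abs sort_map. Qed.

Lemma sign_partial_sumE (R : realType) (n : nat) (x : 'I_n -> R) (k : nat) :
  sign_partial_sum x k =
  \sum_(i <- take k (sort (fun i j => `|x j| <= `|x i|) (enum 'I_n)))
     Num.sg (x i).
Proof. by rewrite /sign_partial_sum sort_by_absE -map_take big_map. Qed.

Lemma cusum_sign_ext (R : realType) (n : nat) (x y : 'I_n -> R) :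
  (forall i j, (`|x j| <= `|x i|) = (`|y j| <= `|y i|)) ->
  (forall i, Num.sg (x i) = Num.sg (y i)) ->
  cusum_sign x = cusum_sign y.
Proof.
move=> xy sxy.
have e k : sign_partial_sum x k = sign_partial_sum y k.
  rewrite !sign_partial_sumE (_ : (fun i j => `|x j| <= `|x i|) =
    (fun i j => `|y j| <= `|y i|)); last by apply/funext => i; apply/funext.
  by apply: eq_bigr => i _.
rewrite /cusum_sign e; congr bigop; apply/funext => k.
by rewrite e.
Qed.

(** In a sorted list such a [p] holds on a prefix: once the head fails, every later entry fails, and
    both sides are empty. *)
Lemma take_count_sorted (T : Type) (leT : rel T) (p : pred T) (s : seq T) :
  transitive leT -> (forall a b, leT a b -> p b -> p a) -> sorted leT s ->
  take (count p s) s = seq.filter p s.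
Proof.
move=> tr ph; elim: s => //= a s IH pas.
have ss := path_sorted pas.
case: ifPn => pa; first by rewrite (add1n (count p s)) /= IH.
have -> : count p s = 0%N.
  apply/eqP; rewrite -leqn0 leqNgt -has_count.
  have := order_path_min tr pas; elim: s {IH pas ss} => //= b s IH /andP[ab abs].
  rewrite negb_or IH // andbT; apply: contra pa; exact: ph.
rewrite (add0n 0) take0; have := order_path_min tr pas.
elim: s {IH pas ss} => //= b s IH /andP[ab abs].
by rewrite ifN ?IH //; apply: contra pa; exact: ph.
Qed.

(** Here the sorting disappears, since a sum over a prefix cut at a threshold does not depend on its
    order. Ties are harmless: equal absolute values lie on the same side of [t]. *)
Lemma sign_partial_sum_threshold (R : realType) (n : nat) (x : 'I_n -> R)
    (t : R) :
  sign_partial_sum x #|[pred i | t < `|x i|]| =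
  \sum_(i | t < `|x i|) Num.sg (x i).
Proof.
rewrite /sign_partial_sum.
have -> : #|[pred i | t < `|x i|]| = count (fun v => t < `|v|) (sort_by_abs x).
  by rewrite /sort_by_abs count_sort count_map cardE size_filter -enumT; apply: eq_count.
rewrite (@take_count_sorted _ (fun a b : R => `|b| <= `|a|)).
- rewrite big_filter (perm_big [seq x i | i <- enum 'I_n]) ?perm_sort //=.
  by rewrite big_map big_enum_cond.
- by move=> b a c /= ab bc; exact: le_trans bc ab.
- by move=> a b ab tb; exact: lt_le_trans ab.
- by apply: sort_sorted => a b; exact: le_total.
Qed.

Lemma le_cusum_sign (R : realType) (n : nat) (x : 'I_n -> R) (k : nat) :
  (0 < k <= n)%N -> sign_partial_sum x k / Num.sqrt k%:R <= cusum_sign x.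
Proof.
move=> /andP[k0 kn]; rewrite /cusum_sign.
apply: (@Order.TotalTheory.le_bigmax_seq _ _ _ _ _ k predT
  (fun j => sign_partial_sum x j / Num.sqrt j%:R)) => //.
by rewrite mem_index_iota k0 ltnS.
Qed.

Lemma cusum_sign_gt (R : realType) (n : nat) (x : 'I_n -> R) (u : R) :
  (0 < n)%N -> u < cusum_sign x ->
  exists k : 'I_n, u < sign_partial_sum x k.+1 / Num.sqrt k.+1%:R.
Proof.
move=> n0; apply: contraPP => /forallNP h; apply/negP; rewrite -leNgt.
have hk k : (0 < k <= n)%N -> sign_partial_sum x k / Num.sqrt k%:R <= u.
  case: k => // k kn; rewrite leNgt; apply/negP; exact: (h (Ordinal kn)).
rewrite /cusum_sign big_seq; apply: bigmax_le; first exact: hk.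
by move=> k; rewrite mem_index_iota ltnS; exact: hk.
Qed.

(** * Measurability of the statistic *)

Lemma ffun_fiber_measurable d (T : measurableType d) (I D : finType)
    (f : T -> {ffun I -> D}) (e : {ffun I -> D}) :
  (forall i y, measurable [set w | f w i = y]) ->
  measurable (f @^-1` [set e]).
Proof.
move=> mf; rewrite (_ : f @^-1` _ = \bigcap_(i in [set: I]) [set w | f w i = e i]).
  by apply: fin_bigcap_measurable => [|i _]; [exact: finite_finset|exact: mf].
apply/seteqP; split => [w /= <- //|w h]; apply/ffunP => i; exact: h.
Qed.

Lemma bool_fiber_measurable d (T : measurableType d) (f : T -> bool) (b : bool) :
  measurable_fun setT f -> measurable [set w | f w = b].
Proof. by move=> mf; rewrite -[X in measurable X]setTI; exact: (mf measurableT [set b]). Qed.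

(** The statistic factors through a finite type recording the comparisons of absolute values and the
    signs ([Num.sg] has three values, hence two tests). So even an arbitrary [A] pulls back to a
    finite union of measurable fibres. *)
Lemma cusum_sign_measurable (R : realType) d (T : measurableType d) (n : nat)
    (X : 'I_n -> T -> R) (A : set R) :
  (forall i, measurable_fun setT (X i)) ->
  measurable ((fun w => cusum_sign (fun i => X i w)) @^-1` A).
Proof.
move=> mX.
pose f1 w := [ffun ij : 'I_n * 'I_n => `|X ij.2 w| <= `|X ij.1 w|].
pose f2 w := [ffun i : 'I_n => X i w == 0].
pose f3 w := [ffun i : 'I_n => X i w < 0].
pose f w := (f1 w, f2 w, f3 w).
rewrite (_ : _ @^-1` _ = f @^-1` (f @` ((fun w => cusum_sign (fun i => X i w)) @^-1` A))).
  apply: preimage_fintype_measurable => -[[e1 e2] e3].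
  rewrite (_ : _ @^-1` _ = (f1 @^-1` [set e1] `&` f2 @^-1` [set e2]) `&` f3 @^-1` [set e3]).
    apply: measurableI; first apply: measurableI.
    - apply: ffun_fiber_measurable => ij y.
      under eq_set do rewrite ffunE.
      apply: bool_fiber_measurable; apply: measurable_fun_ler; exact: measurableT_comp.
    - apply: ffun_fiber_measurable => ij y.
      under eq_set do rewrite ffunE.
      by apply: bool_fiber_measurable; apply: measurable_fun_eqr.
    - apply: ffun_fiber_measurable => ij y.
      under eq_set do rewrite ffunE.
      by apply: bool_fiber_measurable; apply: measurable_fun_ltr.
  by apply/seteqP; rewrite /f; split => [w /= [<- <- <-]|w /= [[<- <-] <-]].
apply/seteqP; split => [w Aw|w /= [v Av [e1 e2 e3]]]; first by exists w.
suff -> : cusum_sign (fun i => X i w) = cusum_sign (fun i => X i v) by [].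
apply: cusum_sign_ext => [i j|i].
  by have /ffunP/(_ (i, j)) := e1; rewrite !ffunE.
rewrite !sgr_def.
by have /ffunP/(_ i) := e2; have /ffunP/(_ i) := e3; rewrite !ffunE => -> ->.
Qed.

(** The Lipschitz bound rules out an atom at [x]: [F] slightly to the left of [x] is already within
    [e] of [F x]. *)
Lemma probability_lt_cdf (R : realType) d (T : measurableType d)
    (P : probability T R) (X : {RV P >-> R}) (F : R -> R) (K x : R) :
  (forall y, cdf X y = (F y)%:E) ->
  (forall a b, a <= b -> F b - F a <= K * (b - a)) ->
  P (X @^-1` `]-oo, x[) = (F x)%:E.
Proof.
move=> FX FK; have cE y : P (X @^-1` `]-oo, y]) = (F y)%:E by rewrite -FX.
have mX A : measurable A -> measurable (X @^-1` A) by move=> mA; exact: measurable_sfunP.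
apply/eqP; rewrite eq_le; apply/andP; split.
  by rewrite -cE le_measure ?inE//; try exact: mX; move=> w /=; rewrite !in_itv /=; exact: ltW.
rewrite -[leRHS]fineK ?fin_num_measure//; last exact: mX.
rewrite lee_fin; apply/ler_addgt0Pr => e e0.
(* [K] may be zero or negative, so the step to the left is [e / (|K| + 1)]. *)
have K0 : 0 < `|K| + 1 by rewrite ltr_wpDl.
have h : F (x - e / (`|K| + 1)) <= fine (P (X @^-1` `]-oo, x[)).
  rewrite -lee_fin fineK ?fin_num_measure//; last exact: mX.
  rewrite -cE le_measure ?inE//; try exact: mX.
  move=> w /=; rewrite !in_itv /= => /le_lt_trans; apply.
  by rewrite ltrBlDr ltrDl divr_gt0.
have h2 : K * (e / (`|K| + 1)) <= e.
  rewrite mulrCA; apply: ler_piMr; [exact: ltW|rewrite ler_pdivrMr // mul1r].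
  by rewrite (le_trans (ler_norm _)) // lerDl.
have h3 : x - e / (`|K| + 1) <= x by rewrite gerBl divr_ge0 ?ltW.
by have := FK _ _ h3; rewrite subKr; lra.
Qed.

(* The half-line [0 <= v] stands for a positive sign: the atom at 0 is null. *)
Lemma probability_sign_abs (R : realType) d (T : measurableType d)
    (P : probability T R) (X : {RV P >-> R}) (F : R -> R) (K : R)
    (b : bool) (t : R) :
  (forall y, cdf X y = (F y)%:E) ->
  (forall a b, a <= b -> F b - F a <= K * (b - a)) ->
  (forall x, F (- x) = 1 - F x) ->
  P (X @^-1` [set v | (0 <= v) = b /\ t < `|v|]) =
  ((1 / 2)%:E * P (X @^-1` [set v | (t < `|v|)%R]))%E.
Proof.
move=> FX FK FN.
have mX A : measurable A -> measurable (X @^-1` A) by move=> mA; exact: measurable_sfunP.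
have lE x : P (X @^-1` `]-oo, x[) = (F x)%:E by exact: probability_lt_cdf FX FK.
have gE x : P (X @^-1` `]x, +oo[) = (1 - F x)%:E.
  by rewrite -[LHS]/(ccdf X x) ccdf_1_cdf FX -EFinB.
have geE x : P (X @^-1` `[x, +oo[) = (1 - F x)%:E.
  rewrite (_ : _ @^-1` _ = ~` (X @^-1` `]-oo, x[)).
    by rewrite probability_setC ?lE//; exact: mX.
  by apply/seteqP; split => w /=; rewrite !in_itv /= andbT leNgt => /negP.
have F0 : F 0 = 1 / 2 by have := FN 0; rewrite oppr0; lra.
(* For negative [t] the condition on the absolute value is vacuous and only the sign remains. Such
   thresholds occur later to leave a coordinate free. *)
pose B b := if t < 0 then (if b then `[0, +oo[%classic else `]-oo, 0[%classic)
  else (if b then `]t, +oo[%classic else `]-oo, - t[%classic) : set R.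
have BE c : [set v : R | (0 <= v) = c /\ t < `|v|] = B c.
  rewrite /B; have [t0|t0] := ltP t 0; case: c; apply/seteqP; split => v /=;
    rewrite in_itv /= ?andbT.
  - by case.
  - by split => //; exact: lt_le_trans t0 _.
  - by case=> /negbT; rewrite -ltNge.
  - by move=> v0; split; [apply/negbTE; rewrite -ltNge|exact: lt_le_trans t0 _].
  - by case=> v0; rewrite ger0_norm.
  - by move=> tv; have v0 := le_lt_trans t0 tv; rewrite ltW // gtr0_norm.
  - by case=> /negbT; rewrite -ltNge => v0; rewrite ltr0_norm // ltrNr.
  - move=> tv; have v0 : v < 0 by rewrite (lt_le_trans tv) // oppr_le0.
    by rewrite ltr0_norm // leNgt v0 /= -ltrNr.
have mB c : measurable (B c) by rewrite /B; case: ifP => _; case: c.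
have PB c : P (X @^-1` B c) = (if t < 0 then 1 / 2 else 1 - F t)%:E.
  rewrite /B; case: ifP => _; case: c; rewrite ?geE ?lE ?gE ?F0 ?FN //.
  by congr EFin; lra.
rewrite BE PB.
have -> : [set v : R | t < `|v|] = B true `|` B false.
  rewrite -!BE; apply/seteqP; split => v /=; last by case=> -[].
  by move=> tv; case: (0 <= v); [left|right].
have -> : (P (X @^-1` (B true `|` B false)) =
    P (X @^-1` B true) + P (X @^-1` B false))%E.
  rewrite preimage_setU measureU; [by []|exact: mX|exact: mX|].
  by rewrite -preimage_setI -!BE; apply/seteqP; split => // w [/= [-> _] []].
by rewrite !PB -EFinD -EFinM; congr EFin; lra.
Qed.

(** * The null hypothesis *)

Lemma mutually_independentT (R : realType) d (T : measurableType d)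
    (P : probability T R) (n : nat) (X : 'I_n -> {RV P >-> R})
    (B : 'I_n -> set R) :
  mutually_independent X -> (forall i, measurable (B i)) ->
  P (\bigcap_(i in [set: 'I_n]) (X i @^-1` B i)) =
  (\prod_i P (X i @^-1` B i))%E.
Proof.
move=> indX mB; have := indX [set: 'I_n]%SET B mB.
rewrite (_ : [set` [set: 'I_n]%SET] = [set: 'I_n]); last first.
  by apply/seteqP; split => // i _ /=; rewrite inE.
by move=> ->; apply: eq_bigl => i; rewrite inE.
Qed.

(** A pi-system (intersections take the maximum of the thresholds) generating the sigma-algebra of
    the vector of absolute values; a negative threshold leaves its coordinate free. *)
Definition abs_system (R : realType) (T : Type) (n : nat) (X : 'I_n -> T -> R)
    : set (set T) :=
  [set E | exists t : 'I_n -> R,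
     E = \bigcap_(i in [set: 'I_n]) [set w | t i < `|X i w|]].

(** Equip [T] with the generated sigma-algebra: each absolute value becomes measurable, hence so do
    their comparisons. *)
Lemma abs_system_order (R : realType) d (T : measurableType d) (n : nat)
    (X : 'I_n -> T -> R) (c : {ffun 'I_n * 'I_n -> bool}) :
  <<s abs_system X >>
    [set w | [ffun ij : 'I_n * 'I_n => `|X ij.2 w| <= `|X ij.1 w|] = c].
Proof.
pose T' := g_sigma_algebraType (abs_system X).
have mX i : measurable_fun [set: T'] (fun w : T' => `|X i w|).
  apply: (@measurability _ _ _ _ _ _ (@RGenOInfty.G R)).
    exact: RGenOInfty.measurableE.
  move=> _ [_ [x ->] <-]; rewrite setTI; apply: sub_sigma_algebra.
  exists (fun j => if j == i then x else -1); apply/seteqP; split => w /=.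
    rewrite in_itv /= andbT => xw j _ /=; case: eqP => [-> //|_].
    by rewrite (lt_le_trans _ (normr_ge0 _)).
  by move=> /(_ i Logic.I) /=; rewrite eqxx in_itv /= andbT.
apply: (@ffun_fiber_measurable _ T' _ _
  (fun w => [ffun ij : 'I_n * 'I_n => `|X ij.2 w| <= `|X ij.1 w|])) => ij y.
under eq_set do rewrite ffunE.
by apply: bool_fiber_measurable; apply: measurable_fun_ler.
Qed.

(** Two finite measures that agree on a pi-system agree on what it generates. Here they are [P]
    restricted to the sign event and [P] scaled by 2^(-n); on [abs_system] they agree by mutual
    independence and the symmetry of each coordinate. *)
Lemma sign_abs_independent (R : realType) d (T : measurableType d)
    (P : probability T R) (n : nat) (X : 'I_n -> {RV P >-> R})
    (F : R -> R) (K : R) (s : {ffun 'I_n -> bool}) (E : set T) :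
  iid_with_cdf X F ->
  (forall a b, a <= b -> F b - F a <= K * (b - a)) ->
  (forall x, F (- x) = 1 - F x) ->
  <<s abs_system X >> E ->
  P (E `&` \bigcap_(i in [set: 'I_n]) [set w | (0 <= X i w) = s i]) =
  (((1 / 2) ^+ n)%:E * P E)%E.
Proof.
move=> [indX FX] FK FN.
set A := \bigcap_(i in _) _.
have mabs (t : R) : measurable [set v : R | t < `|v|].
  by rewrite -[X in measurable X]setTI -preimage_true; apply: measurable_fun_ltr.
have msg (b : bool) : measurable [set v : R | (0 <= v) = b].
  by apply: bool_fiber_measurable; apply: measurable_fun_ler.
have mX i B : measurable B -> measurable (X i @^-1` B).
  by move=> mB; exact: measurable_sfunP.
have mA : measurable A.
  apply: fin_bigcap_measurable => [|i _]; first exact: finite_finset.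
  exact: mX (msg (s i)).
have hn : 0 <= (1 / 2 : R) ^+ n by rewrite exprn_ge0.
have Gm : abs_system X `<=` measurable.
  move=> _ [t ->]; apply: fin_bigcap_measurable => [|i _]; first exact: finite_finset.
  exact: mX (mabs (t i)).
apply: (@g_sigma_algebra_measure_unique _ R T (abs_system X) Gm (fun=> setT) _ _
  (mrestr P mA) (mscale (NngNum hn) P)).
- move=> _; exists (fun=> -1); apply/seteqP; split => // w _ i _ /=.
  by rewrite (lt_le_trans _ (normr_ge0 _)).
- by apply/seteqP; split => // w _; exists 0%N.
- move=> _ _ [t ->] [t' ->]; exists (fun i => Num.max (t i) (t' i)).
  rewrite -bigcapI; apply: eq_bigcapr => i _; apply/seteqP.
  by split => w /=; rewrite gt_max => /andP.
- move=> _ [t ->]; rewrite /= /mrestr /mscale /=.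
  rewrite /A -bigcapI.
  have -> : \bigcap_(i in [set: 'I_n])
     ([set w | t i < `|X i w|] `&` [set w | (0 <= X i w) = s i]) =
     \bigcap_(i in [set: 'I_n]) (X i @^-1` [set v | (0 <= v) = s i /\ t i < `|v|]).
    by apply: eq_bigcapr => i _; apply/seteqP; split => w /= [].
  rewrite (mutually_independentT indX); last first.
    by move=> i; exact: measurableI (msg (s i)) (mabs (t i)).
  rewrite (mutually_independentT (B := fun i => [set v | t i < `|v|]) indX) //.
  under eq_bigr do rewrite (probability_sign_abs _ _ (FX _) FK FN).
  rewrite big_split /=; congr (_ * _)%E.
  by rewrite prodEFin prodr_const card_ord.
- move=> _; rewrite /= /mrestr setTI.
  by rewrite (le_lt_trans (probability_le1 _ _)) // ltry.
Qed.

(** * The random walk of signs, given the order of the absolute values *)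

Definition bool_sign (R : realType) (b : bool) : R := if b then 1 else -1.

(** A zero observation is counted as +1: the sign vector then consists of exact fair coins and
    dominates [Num.sg], the direction that an upper tail requires. *)
Lemma sgr_le_bool_sign (R : realType) (v : R) : Num.sg v <= bool_sign R (0 <= v).
Proof. by rewrite /bool_sign; case: sgrP => _; rewrite ?ler01. Qed.

(** For a frozen order pattern [c] the first [k] indices are deterministic, so these are independent
    terms in the coins. The Chernoff parameter 1 / (2 sqrt k) is built in. *)
Definition walk_increment (R : realType) (n k : nat)
    (c : {ffun 'I_n * 'I_n -> bool}) (i : 'I_n) (b : bool) : R :=
  if i \in take k (sort (fun i j => c (i, j)) (enum 'I_n))
  then (2 * Num.sqrt k%:R)^-1 * bool_sign R b else 0.

(** With [l = 1 / (2 sqrt k) <= 1/2], one coin contributes at most [1 + 2 l^2 <= exp (1 / (2 k))],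
    and at most [k] coins are active. *)
Lemma walk_increment_mgf (R : realType) (n k : nat)
    (c : {ffun 'I_n * 'I_n -> bool}) :
  (0 < k)%N ->
  \prod_i \sum_b 1 / 2 * expR (walk_increment R k c i b) <= expR (1 / 2).
Proof.
move=> k0; set K := take k (sort (fun i j => c (i, j)) (enum 'I_n)).
have kR : 0 < k%:R :> R by rewrite ltr0n.
have s0 : 0 < Num.sqrt k%:R :> R by rewrite sqrtr_gt0.
set l := (2 * Num.sqrt k%:R)^-1 : R.
have s1 : 1 <= Num.sqrt k%:R :> R by rewrite -[leLHS]sqrtr1 ler_sqrt // ler1n.
have l0 : 0 <= l by rewrite invr_ge0 mulr_ge0 // ltW.
have l1 : l <= 1 / 2.
  by rewrite /l div1r lef_pV2 ?posrE ?mulr_gt0 // ler_peMr.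
have l2 : 2 * l ^+ 2 = (2 * k%:R)^-1.
  rewrite /l exprVn exprMn sqr_sqrtr ?ltW // (_ : 2 ^+ 2 = 2 * 2 :> R) ?expr2 //.
  by field; rewrite gt_eqF.
apply: (@le_trans _ _ (\prod_(i < n) expR (if i \in K then (2 * k%:R)^-1 else 0))).
  apply: ler_prod => i _; apply/andP; split.
    by apply: sumr_ge0 => b _; rewrite mulr_ge0 ?expR_ge0.
  rewrite big_bool /walk_increment -/K -/l /=; case: ifP => _; last first.
    by rewrite expR0; lra.
  rewrite mulr1 mulrN1 -l2.
  have h1 : expR l <= 1 + l + 2 * l ^+ 2 by apply: expR_le_quadratic; rewrite ger0_norm.
  have h2 : expR (- l) <= 1 - l + 2 * (- l) ^+ 2.
    by apply: expR_le_quadratic; rewrite normrN ger0_norm.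
  have := expR_ge1Dx (2 * l ^+ 2); rewrite sqrrN in h2; lra.
rewrite -expR_sum ler_expR -big_mkcond /= sumr_const.
have cK : (#|K| <= k)%N.
  by rewrite (leq_trans (card_size _)) // size_take_min geq_minl.
apply: (@le_trans _ _ ((2 * k%:R)^-1 *+ k)).
  rewrite -[leLHS]mulr_natr -[leRHS]mulr_natr; apply: ler_wpM2l; last by rewrite ler_nat.
  by rewrite invr_ge0 mulr_ge0 // ltW.
rewrite -[leLHS]mulr_natr (_ : _ * _ = 1 / 2) //.
by field; rewrite gt_eqF.
Qed.

Lemma sign_partial_sum_le_walk (R : realType) (n k : nat) (x : 'I_n -> R) :
  (0 < k)%N ->
  sign_partial_sum x k / Num.sqrt k%:R / 2 <=
  \sum_i walk_increment R k [ffun ij => `|x ij.2| <= `|x ij.1|] i (0 <= x i).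
Proof.
move=> k0; have s0 : 0 < Num.sqrt k%:R :> R by rewrite sqrtr_gt0 ltr0n.
rewrite -big_mkcond /= -mulr_sumr sign_partial_sumE.
have -> : (fun i j : 'I_n => [ffun ij => `|x ij.2| <= `|x ij.1|] (i, j)) =
          (fun i j => `|x j| <= `|x i|).
  by apply/funext => i; apply/funext => j; rewrite ffunE.
rewrite -mulrA mulrC -invfM (mulrC _ 2) ler_pM2l ?invr_gt0 ?mulr_gt0 //.
rewrite -big_uniq ?take_uniq ?sort_uniq ?enum_uniq //=.
by apply: ler_sum => i _; exact: sgr_le_bool_sign.
Qed.

Lemma cusum_sign_null_tail (R : realType) d (T : measurableType d)
    (P : probability T R) (n : nat) (X : 'I_n -> {RV P >-> R})
    (F : R -> R) (K u : R) :
  (0 < n)%N -> iid_with_cdf X F ->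
  (forall a b, a <= b -> F b - F a <= K * (b - a)) ->
  (forall x, F (- x) = 1 - F x) ->
  (P [set w | (u < cusum_sign (fun i => X i w))%R] <=
   (n%:R * expR (1 / 2 - u / 2))%:E)%E.
Proof.
move=> n0 iidX FK FN.
have mX i : measurable_fun setT (X i) by exact: measurable_funPT.
pose f1 w := [ffun ij : 'I_n * 'I_n => `|X ij.2 w| <= `|X ij.1 w|].
pose f2 w := [ffun i => 0 <= X i w].
pose f w := (f1 w, f2 w).
have mf1 c : measurable (f1 @^-1` [set c]).
  apply: ffun_fiber_measurable => ij y; under eq_set do rewrite ffunE.
  by apply: bool_fiber_measurable; apply: measurable_fun_ler; exact: measurableT_comp.
have mf2 s : measurable (f2 @^-1` [set s]).
  apply: ffun_fiber_measurable => i y; under eq_set do rewrite ffunE.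
  by apply: bool_fiber_measurable; apply: measurable_fun_ler.
have fE c s : f @^-1` [set (c, s)] = f1 @^-1` [set c] `&` f2 @^-1` [set s].
  by apply/seteqP; rewrite /f; split => [w /= [<- <-]|w /= [<- <-]].
have mf e : measurable (f @^-1` [set e]).
  by case: e => c s; rewrite fE; exact: measurableI.
have Pf c s : P (f @^-1` [set (c, s)]) =
    (((1 / 2) ^+ n)%:E * P (f1 @^-1` [set c]))%E.
  rewrite fE -(sign_abs_independent s iidX FK FN (@abs_system_order R _ T n (fun i => X i) c)).
  congr (P (_ `&` _)); apply/seteqP; split => w /=.
    by move=> <- i _ /=; rewrite ffunE.
  by move=> h; apply/ffunP => i; rewrite ffunE; exact: h.
pose p c := fine (P (f1 @^-1` [set c])).
have pE c : P (f1 @^-1` [set c]) = (p c)%:E by rewrite fineK ?fin_num_measure.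
have p0 c : 0 <= p c by rewrite -lee_fin -pE.
have p1 : \sum_c p c = 1.
  have : (P setT = \sum_c P (f1 @^-1` [set c]))%E.
    rewrite (_ : setT = f1 @^-1` [set` xpredT]); last by apply/seteqP.
    exact: probability_preimage_fintype.
  rewrite probability_setT; under eq_bigr do rewrite pE.
  by rewrite sumEFin => -[].
(* A sum [S_k / sqrt k > u] forces the scaled walk to reach [u / 2]; the shift to [k.+1] matches
   indices starting at 1. *)
pose A (k : nat) : pred ({ffun 'I_n * 'I_n -> bool} * {ffun 'I_n -> bool}) :=
  fun e => u / 2 <= \sum_i walk_increment R k.+1 e.1 i (e.2 i).
have PA k : (P (f @^-1` [set` A k]) <= (expR (1 / 2 - u / 2))%:E)%E.
  rewrite probability_preimage_fintype //.
  rewrite (eq_bigr (fun e => ((1 / 2) ^+ n * p e.1)%:E)); last first.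
    by case=> c s _; rewrite Pf pE EFinM.
  rewrite sumEFin lee_fin.
  rewrite -(pair_big_dep xpredT (fun c s => A k (c, s))
    (fun c s => (1 / 2) ^+ n * p c)) /=.
  (* The Chernoff bound is uniform in the pattern [c], so averaging with the weights [p c], of total
     mass 1, preserves it. *)
  rewrite -[leRHS]mulr1 -[X in _ <= _ * X]p1 mulr_sumr; apply: ler_sum => c _.
  rewrite -mulr_suml; apply: ler_wpM2r => //.
  have := chernoff_weighted_sum (p := fun (_ : 'I_n) (_ : bool) => 1 / 2)
    (walk_increment R k.+1 c) (u / 2).
  move=> /(_ (fun _ _ => ltac:(by rewrite divr_ge0))).
  rewrite (eq_bigr (fun _ => (1 / 2) ^+ n)); last first.
    by move=> s _; rewrite prodr_const card_ord.
  move=> /le_trans; apply.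
  rewrite [1 / 2 - _]addrC expRD; apply: ler_wpM2l; first exact: expR_ge0.
  exact: walk_increment_mgf.
have sub : [set w | u < cusum_sign (fun i => X i w)] `<=`
    \big[setU/set0]_(k < n) f @^-1` [set` A k].
  move=> w /= uw; have [k uk] := cusum_sign_gt n0 uw.
  rewrite -(bigcup_mkord n (fun k => f @^-1` [set` A k])); exists k => //=.
  rewrite /in_mem /= /A /=.
  have h := sign_partial_sum_le_walk (fun i => X i w) (ltn0Sn k).
  rewrite (eq_bigr (fun i => walk_increment R k.+1 (f1 w) i (0 <= X i w))); last first.
    by move=> i _; rewrite ffunE.
  by apply: le_trans _ h; rewrite ler_pM2r ?invr_gt0 // ltW.
have mA k : measurable (f @^-1` [set` A k]) by exact: preimage_fintype_measurable.
apply: (@le_trans _ _ (P (\big[setU/set0]_(k < n) f @^-1` [set` A k]))).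
  rewrite le_measure ?inE //; last by apply: bigsetU_measurable => k _; exact: mA.
  by have := cusum_sign_measurable `]u, +oo[%classic mX;
    rewrite /preimage /=; under eq_set do rewrite in_itv /= andbT.
apply: (le_trans (Boole_inequality P (A := fun k => f @^-1` [set` A k]) _)) => [k _|].
  exact: mA.
apply: (@le_trans _ _ (\sum_(k < n) (expR (1 / 2 - u / 2))%:E)%E).
  by apply: lee_sum => k _; exact: PA.
by rewrite sumEFin lee_fin sumr_const card_ord mulr_natl.
Qed.

(** * The alternative *)

Definition tail_side (R : realType) (t x : R) : option bool :=
  if t < x then Some true else if x < - t then Some false else None.

Definition side_value (R : realType) (y : option bool) : R :=
  if y is Some b then bool_sign R b else 0.

(** Numerator and squared denominator of the chosen ratio are both sums of functions of one
    three-valued variable per observation, so the finite Chernoff bound covers both. *)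
Lemma sign_partial_sum_tail_side (R : realType) (n : nat) (x : 'I_n -> R) (t : R) :
  0 <= t ->
  sign_partial_sum x #|[pred i | t < `|x i|]| =
    \sum_i side_value R (tail_side t (x i)) /\
  #|[pred i | t < `|x i|]|%:R = \sum_i `|side_value R (tail_side t (x i))|.
Proof.
move=> t0; have h v : (t < `|v|) = (tail_side t v != None).
  by rewrite ltr_normr /tail_side ltrNr; case: ifP => //; case: ifP.
split.
  rewrite sign_partial_sum_threshold big_mkcond /=; apply: eq_bigr => i _.
  rewrite h /tail_side; case: ltP => [ti|_] /=.
    by rewrite gtr0_sg // (le_lt_trans t0).
  by case: ltP => //= ti; rewrite ltr0_sg // (lt_le_trans ti) // oppr_le0.
rewrite -sum1_card natr_sum big_mkcond /=; apply: eq_bigr => i _.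
by rewrite inE h; case: tail_side => [[]|] //=; rewrite ?normrN ?normr1 ?normr0.
Qed.

Lemma tail_side_measurable (R : realType) (t : R) (y : option bool) :
  measurable [set x : R | tail_side t x = y].
Proof.
pose f (x : R) := (t < x, x < - t).
rewrite (_ : [set x : R | _] = f @^-1` [set ab |
  (if ab.1 then Some true else if ab.2 then Some false else None) = y]) //.
apply: preimage_fintype_measurable => -[a b].
rewrite (_ : _ @^-1` _ = [set x : R | (t < x) = a] `&` [set x : R | (x < - t) = b]).
  by apply: measurableI; apply: bool_fiber_measurable; exact: measurable_fun_ltr.
by apply/seteqP; rewrite /f; split => x /= [<- <-].
Qed.

Lemma sum_option_bool (V : nmodType) (f : option bool -> V) :
  \sum_y f y = f None + (f (Some true) + f (Some false)).
Proof.
rewrite (bigD1 None) //= (bigD1 (Some true)) //= (bigD1 (Some false)) //=.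
by rewrite big1 ?addr0 // => -[[]|].
Qed.

(** One-observation bounds for the two ways to fail: a sum that is too small, a count that is too
    large. Expand each exponential to second order, then use [1 + z <= exp z]. *)
Lemma side_mgf (R : realType) (q : option bool -> R) (dl p l : R) :
  (forall y, 0 <= q y) -> \sum_y q y = 1 ->
  dl <= q (Some true) - q (Some false) ->
  q (Some true) + q (Some false) <= p ->
  0 <= l <= 1 / 2 ->
  \sum_y q y * expR (- (l * side_value R y)) <= expR (- (l * dl) + 2 * l ^+ 2 * p) /\
  \sum_y q y * expR (l * `|side_value R y|) <= expR ((l + 2 * l ^+ 2) * p).
Proof.
move=> q0; rewrite !sum_option_bool /= => q1 qd qp /andP[l0 l1].
have h1 : expR l <= 1 + l + 2 * l ^+ 2 by apply: expR_le_quadratic; rewrite ger0_norm.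
have h2 : expR (- l) <= 1 - l + 2 * (- l) ^+ 2.
  by apply: expR_le_quadratic; rewrite normrN ger0_norm.
rewrite sqrrN in h2.
have [qt qf] : 0 <= q (Some true) /\ 0 <= q (Some false) by [].
rewrite /bool_sign /= mulr1 mulrN1 opprK normrN normr1 normr0 mulr0 mulr1 oppr0 expR0 !mulr1.
have a1 := ler_wpM2l qt h1; have a2 := ler_wpM2l qt h2.
have b1 := ler_wpM2l qf h1.
have l2 : 0 <= 2 * l ^+ 2 by rewrite mulr_ge0 ?sqr_ge0.
have c1 := ler_wpM2l l0 qd; have c2 := ler_wpM2l l2 qp.
have c3 : (l + 2 * l ^+ 2) * (q (Some true) + q (Some false)) <= (l + 2 * l ^+ 2) * p.
  by apply: ler_wpM2l => //; rewrite addr_ge0.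
split; (eapply le_trans; [|exact: expR_ge1Dx]); lra.
Qed.

Lemma tail_side_fiber_measurable (R : realType) d (T : measurableType d) (n : nat)
    (X : 'I_n -> T -> R) (t : R) (s : {ffun 'I_n -> option bool}) :
  (forall i, measurable_fun setT (X i)) ->
  measurable ((fun w => [ffun i => tail_side t (X i w)]) @^-1` [set s]).
Proof.
move=> mX; apply: ffun_fiber_measurable => i y; under eq_set do rewrite ffunE.
by rewrite -[X in measurable X]setTI; exact: (mX i measurableT _ (tail_side_measurable t y)).
Qed.

Lemma sum_side_preimage (R : realType) (T : Type) (n : nat)
    (X : 'I_n -> T -> R) (t a : R) (g : option bool -> R) :
  [set w | (a <= \sum_i g (tail_side t (X i w)))] =
  (fun w => [ffun i => tail_side t (X i w)]) @^-1`
    [set` (fun s : {ffun 'I_n -> option bool} => a <= \sum_i g (s i))].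
Proof.
have e w : \sum_i g ([ffun i => tail_side t (X i w)] i) =
    \sum_i g (tail_side t (X i w)) by apply: eq_bigr => i _; rewrite ffunE.
by apply/seteqP; split => w /=; rewrite /in_mem /= e.
Qed.

Lemma sum_side_ge_tail (R : realType) d (T : measurableType d)
    (P : probability T R) (n : nat) (X : 'I_n -> {RV P >-> R}) (t a c : R)
    (g : option bool -> R) :
  mutually_independent X ->
  (forall i, \sum_y fine (P (X i @^-1` [set x | tail_side t x = y])) * expR (g y)
     <= expR c) ->
  (P [set w | (a <= \sum_i g (tail_side t (X i w)))%R] <= (expR (n%:R * c - a))%:E)%E.
Proof.
move=> indX hc.
pose f w := [ffun i => tail_side t (X i w)].
have mX i y : measurable (X i @^-1` [set x | tail_side t x = y]).
  by rewrite -[X in measurable X]setTI; apply: measurable_funPT => //; exact: tail_side_measurable.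
pose q i y := fine (P (X i @^-1` [set x | tail_side t x = y])).
have qE i y : P (X i @^-1` [set x | tail_side t x = y]) = (q i y)%:E.
  by rewrite fineK ?fin_num_measure.
have q0 i y : 0 <= q i y by rewrite -lee_fin -qE.
have Pf s : P (f @^-1` [set s]) = (\prod_i q i (s i))%:E.
  rewrite -prodEFin -(eq_bigr _ (fun i _ => qE i (s i))).
  rewrite -(mutually_independentT (B := fun i => [set x | tail_side t x = s i]) indX).
    congr (P _); apply/seteqP; split => w /=; first by move=> <- i _ /=; rewrite ffunE.
    by move=> h; apply/ffunP => i; rewrite ffunE; exact: h.
  by move=> i; exact: tail_side_measurable.
rewrite sum_side_preimage -/f.
rewrite probability_preimage_fintype; last by move=> s; exact: tail_side_fiber_measurable.
rewrite (eq_bigr _ (fun s _ => Pf s)) sumEFin lee_fin.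
apply: (le_trans (chernoff_weighted_sum (fun=> g) a q0)).
rewrite addrC expRD; apply: ler_wpM2l; first exact: expR_ge0.
apply: (@le_trans _ _ (\prod_(i < n) expR c)); last first.
  by rewrite prodr_const card_ord expRM_natl.
apply: ler_prod => i _; rewrite hc andbT.
by apply: sumr_ge0 => y _; rewrite mulr_ge0 ?expR_ge0.
Qed.

(** Off the two events [S <= n dl / 2] and [N >= 2 n p], the ratio [S / sqrt N] exceeds
    [(n dl / 2) / sqrt (2 n p)], which is at least [u]. *)
Lemma cusum_sign_alternative_tail (R : realType) d (T : measurableType d)
    (P : probability T R) (n : nat) (X : 'I_n -> {RV P >-> R})
    (H : R -> R) (t dl p u : R) :
  (0 < n)%N -> iid_with_cdf X H -> 0 <= t -> 0 < dl ->
  dl <= 1 - H t - H (- t) -> 1 - H t + H (- t) <= p ->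
  u * Num.sqrt (2 * n%:R * p) <= n%:R * dl / 2 ->
  (P [set w | (cusum_sign (fun i => X i w) <= u)%R] <=
   (2 * expR (- (n%:R * dl ^+ 2 / (32 * p))))%:E)%E.
Proof.
move=> n0 [indX HX] t0 dl0 hd hp hu.
have nR : 0 < n%:R :> R by rewrite ltr0n.
have mX i B : measurable B -> measurable (X i @^-1` B).
  by move=> mB; rewrite -[X in measurable X]setTI; exact: measurable_funPT.
pose q i y := fine (P (X i @^-1` [set x | tail_side t x = y])).
have qE i y : P (X i @^-1` [set x | tail_side t x = y]) = (q i y)%:E.
  by rewrite fineK ?fin_num_measure //; apply: mX; exact: tail_side_measurable.
have q0 i y : 0 <= q i y by rewrite -lee_fin -qE.
have q1 i : \sum_y q i y = 1.
  have : (P setT = \sum_y P ((fun w => tail_side t (X i w)) @^-1` [set y]))%E.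
    rewrite (_ : setT = (fun w => tail_side t (X i w)) @^-1` [set` xpredT]); last by apply/seteqP.
    by rewrite probability_preimage_fintype // => y; exact: (mX i _ (tail_side_measurable t y)).
  by rewrite probability_setT (eq_bigr _ (fun y _ => qE i y)) sumEFin => -[].
have qt i : q i (Some true) = 1 - H t.
  apply: EFin_inj; rewrite -qE -[X in _ = X](_ : ccdf (X i) t = _); last first.
    by rewrite ccdf_1_cdf HX -EFinB.
  congr (P _); apply/seteqP; rewrite /tail_side; split => w /=; rewrite in_itv /= andbT.
    by case: ltP => // _; case: ifP.
  by move=> ->.
(* Only an inequality, since [H (- t)] also counts a possible atom at [- t]; it goes the right way
   for both [dl] and [p]. *)
have qf i : q i (Some false) <= H (- t).
  rewrite -lee_fin -qE -(HX i) le_measure ?inE //.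
  - by apply: mX; exact: tail_side_measurable.
  - exact: mX.
  move=> w /=; rewrite /tail_side in_itv /=; case: ltP => // _.
  by case: ltP => // + _; exact: ltW.
have p0 : dl <= p by have := q0 (Ordinal n0) (Some false); have := qf (Ordinal n0); lra.
have pp : 0 < p by lra.
(* The minimiser of [- l dl / 2 + 2 l^2 p], whose minimum is [- dl^2 / (32 p)]. *)
pose l1 := dl / (8 * p).
have l1P : 0 <= l1 <= 1 / 2.
  apply/andP; split; first by rewrite /l1 divr_ge0 ?mulr_ge0 ?ltW.
  by rewrite /l1 ler_pdivrMr ?mulr_gt0 //; lra.
pose S w := \sum_i side_value R (tail_side t (X i w)).
pose N w := \sum_i `|side_value R (tail_side t (X i w))|.
pose E := expR (- (n%:R * dl ^+ 2 / (32 * p))).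
have hS : (P [set w | (- (l1 * (n%:R * dl / 2)) <=
    \sum_i - (l1 * side_value R (tail_side t (X i w))))%R] <= E%:E)%E.
  apply: (le_trans (sum_side_ge_tail (t := t) (- (l1 * (n%:R * dl / 2)))
    (c := - (l1 * dl) + 2 * l1 ^+ 2 * p)
    (g := fun y => - (l1 * side_value R y)) indX _)).
    move=> i; apply: (side_mgf (q := q i) _ _ _ _ l1P).1 => //; rewrite ?qt; have := qf i; lra.
  rewrite lee_fin ler_expR le_eqVlt; apply/orP; left; apply/eqP.
  by rewrite /l1; field; rewrite gt_eqF.
(* The parameter 1/4 yields the exponent [- n p / 8], and [dl <= p] brings it below that of [E]. *)
have hN : (P [set w | (4^-1 * (2 * n%:R * p) <=
    \sum_i (4^-1 * `|side_value R (tail_side t (X i w))|))%R] <= E%:E)%E.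
  have l2P : 0 <= (4^-1 : R) <= 1 / 2 by apply/andP; split; lra.
  apply: (le_trans (sum_side_ge_tail (t := t) (4^-1 * (2 * n%:R * p))
    (c := (4^-1 + 2 * 4^-1 ^+ 2) * p)
    (g := fun y => 4^-1 * `|side_value R y|) indX _)).
    move=> i; apply: (side_mgf (q := q i) (dl := dl) _ _ _ _ l2P).2 => //; rewrite ?qt;
      have := qf i; lra.
  rewrite lee_fin ler_expR.
  have -> : n%:R * ((4^-1 + 2 * 4^-1 ^+ 2) * p) - 4^-1 * (2 * n%:R * p) = - (n%:R * (p / 8)).
    by field.
  rewrite lerN2 -mulrA ler_pM2l // ler_pdivrMr ?mulr_gt0 //.
  have h1 : dl ^+ 2 <= p ^+ 2 by apply: lerXn2r; rewrite ?nnegrE //; exact: ltW.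
  have h2 : 0 <= p ^+ 2 by exact: sqr_ge0.
  lra.
have mSN (a : R) g : measurable [set w | (a <= \sum_i g (tail_side t (X i w)))%R].
  rewrite sum_side_preimage; apply: preimage_fintype_measurable => s.
  exact: tail_side_fiber_measurable.
rewrite mulr_natl mulr2n EFinD.
apply: le_trans (leeD hS hN).
set BS := [set w | _] in hS *; set BN := [set w | _] in hN *.
have mBS : measurable BS by exact: (mSN _ (fun y => - (l1 * side_value R y))).
have mBN : measurable BN by exact: (mSN _ (fun y => 4^-1 * `|side_value R y|)).
apply: (@le_trans _ _ (P (BS `|` BN))); last exact: measureU2.
rewrite le_measure ?inE //.
- have := @cusum_sign_measurable R _ T n (fun i => X i) `]-oo, u]%classic.
  by rewrite /preimage /=; under eq_set do rewrite in_itv /=; apply => i; exact: measurable_funPT.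
- exact: measurableU.
move=> w /= Mu; apply: contrapT => /not_orP[/negP + /negP].
rewrite -!ltNge -!mulr_sumr sumrN -mulr_sumr ltrN2 => Sw Nw.
have l10 : 0 < l1 by rewrite /l1 divr_gt0 ?mulr_gt0.
rewrite ltr_pM2l // in Sw; rewrite ltr_pM2l ?invr_gt0 // in Nw.
have [Sk Nk] := sign_partial_sum_tail_side (fun i => X i w) t0.
set k := #|_| in Sk Nk.
have S0 : 0 < S w by rewrite (le_lt_trans _ Sw) // divr_ge0 ?mulr_ge0 ?ltW.
(* A positive sum forces a positive count, so [k] is an admissible index of the maximum. *)
have SN : S w <= N w by apply: ler_sum => i _; exact: ler_norm.
have k0 : (0 < k)%N by rewrite -(ltr0n R) Nk (lt_le_trans S0).
have kn : (k <= n)%N by rewrite (leq_trans (max_card _)) // card_ord.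
have kR : 0 < Num.sqrt k%:R :> R by rewrite sqrtr_gt0 ltr0n.
have := le_cusum_sign (fun i => X i w) (k := k).
rewrite k0 kn => /(_ isT) /le_trans /(_ Mu).
rewrite Sk ler_pdivrMr // leNgt => /negP; apply.
(* Multiplying the bound on [sqrt k] by [u] needs [u >= 0]; otherwise [S w > 0] suffices. *)
have [u0|u0] := leP u 0.
  by rewrite (le_lt_trans _ S0) // mulr_le0_ge0 // ltW.
apply: le_lt_trans Sw; apply: le_trans hu.
by apply: ler_wpM2l; [exact: ltW|apply: ler_wsqrtr; rewrite Nk; exact: ltW].
Qed.

(** * Total variation *)

(** The single set []u, +oo[] gives the lower bound; two probabilities never differ by more than
    1. *)
Lemma tv_dist_bounds (R : realType) d0 d1 (T0 : measurableType d0)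
    (T1 : measurableType d1) (P0 : probability T0 R) (P1 : probability T1 R)
    (S0 : T0 -> R) (S1 : T1 -> R) (u a b : R) :
  (forall A, measurable A -> measurable (S0 @^-1` A)) ->
  (forall A, measurable A -> measurable (S1 @^-1` A)) ->
  (P0 [set w | (u < S0 w)%R] <= a%:E)%E ->
  (P1 [set w | (S1 w <= u)%R] <= b%:E)%E ->
  ((2 * (1 - a - b))%:E <= tv_dist (pushforward P0 S0) (pushforward P1 S1)
    <= 2%:E)%E.
Proof.
move=> m0 m1 ha hb; rewrite /tv_dist /pushforward; apply/andP; split.
  rewrite EFinM lee_pmul2l //.
  apply: le_trans (ereal_sup_ubound _); last first.
    by exists `]u, +oo[%classic => //=.
  have e0 : S0 @^-1` `]u, +oo[ = [set w | (u < S0 w)%R].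
    by apply/seteqP; split => w /=; rewrite in_itv /= andbT.
  have e1 : S1 @^-1` `]u, +oo[ = ~` [set w | (S1 w <= u)%R].
    by apply/seteqP; split => w /=; rewrite in_itv /= andbT ltNge => /negP.
  have m1' : measurable [set w | (S1 w <= u)%R].
    have := m1 `]-oo, u]%classic (measurable_itv _).
    by rewrite /preimage /=; under eq_set do rewrite in_itv /=.
  have m0' : measurable [set w | (u < S0 w)%R] by rewrite -e0; exact: m0.
  rewrite e0 e1 probability_setC //.
  move: ha hb; rewrite -(fineK (fin_num_measure P0 _ m0')) -(fineK (fin_num_measure P1 _ m1')).
  set x := fine _; set y := fine _.
  rewrite (_ : `|x%:E - (1 - y%:E)|%E = `|x - (1 - y)|%:E) // !lee_fin => ha hb.
  by rewrite distrC ler_normr; apply/orP; left; lra.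
rewrite -[leRHS]mule1 lee_pmul2l //.
apply: ge_ereal_sup => _ [A mA <-].
have e0 : P0 (S0 @^-1` A) = (fine (P0 (S0 @^-1` A)))%:E.
  by rewrite fineK // fin_num_measure //; exact: m0.
have e1 : P1 (S1 @^-1` A) = (fine (P1 (S1 @^-1` A)))%:E.
  by rewrite fineK // fin_num_measure //; exact: m1.
have x1 : fine (P0 (S0 @^-1` A)) <= 1 by rewrite -lee_fin -e0 probability_le1 //; exact: m0.
have y1 : fine (P1 (S1 @^-1` A)) <= 1 by rewrite -lee_fin -e1 probability_le1 //; exact: m1.
have x0 : 0 <= fine (P0 (S0 @^-1` A)) by rewrite fine_ge0.
have y0 : 0 <= fine (P1 (S1 @^-1` A)) by rewrite fine_ge0.
rewrite e0 e1 (_ : `|_%:E - _%:E|%E = `|fine (P0 (S0 @^-1` A)) - fine (P1 (S1 @^-1` A))|%:E) //.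
by rewrite lee_fin ler_norml; apply/andP; split; lra.
Qed.

(** * Powers of n against exponentials *)

Lemma powR_natr_large (R : realType) (c A : R) :
  0 < c -> \forall n \near \oo, A <= n%:R `^ c.
Proof.
move=> c0; near=> n.
have h : (`|A| + 1) `^ c^-1 <= n%:R by near: n; exact: nbhs_infty_ger.
have A1 : 0 <= `|A| + 1 by rewrite addr_ge0.
apply: (@le_trans _ _ (`|A| + 1)); first by rewrite (le_trans (ler_norm _)) // lerDl.
have -> : `|A| + 1 = ((`|A| + 1) `^ c^-1) `^ c by rewrite -powRrM mulVf ?powRr1 ?gt_eqF.
by apply: ge0_ler_powR => //; rewrite ?nnegrE ?powR_ge0 // ltW.
Unshelve. all: by end_near.
Qed.

Lemma cvg_expRN_powR (R : realType) (c : R) : 0 < c ->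
  2 * expR (- (n%:R `^ c / 32)) @[n --> \oo] --> (0 : R).
Proof.
move=> c0; apply/cvgr0Pnorm_le => e e0; near=> n.
have h : 64 / e <= n%:R `^ c by near: n; exact: powR_natr_large.
have n0 : 0 < n%:R `^ c :> R by rewrite (lt_le_trans _ h) // divr_gt0.
rewrite ger0_norm ?mulr_ge0 ?expR_ge0 // expRN ler_pdivrMr ?expR_gt0 //.
rewrite ler_pdivrMr // in h.
have := expR_ge1Dx (n%:R `^ c / 32); rewrite -(ler_pM2l e0); lra.
Unshelve. all: by end_near.
Qed.

Lemma exists_natr_mul_ge2 (R : realType) (c : R) :
  0 < c -> exists m : nat, 2 <= c * m.+1%:R.
Proof.
move=> c0; have c2 : 0 <= 2 / c by rewrite divr_ge0 // ltW.
exists (Num.bound (2 / c)); rewrite mulrC -ler_pdivrMr // ltW //.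
by rewrite (lt_le_trans (archi_boundP c2)) // ler_nat.
Qed.

Lemma cvg_mul_expRN_sqrt_powR (R : realType) (c : R) : 0 < c ->
  n%:R * expR (1 / 2 - Num.sqrt (n%:R `^ c / 8) / 2) @[n --> \oo] --> (0 : R).
Proof.
move=> c0; have [m hm] := exists_natr_mul_ge2 c0.
(* With [x^2 = n^c / 32] and [c (m + 1) >= 2], the Taylor term of degree [2 (m + 1)] bounds [exp x]
   below by a multiple of n^2; the sequence is then at most [C / n]. *)
pose C : R := expR (1 / 2) * (2 * m.+1)`!%:R * 32 ^+ m.+1.
have C0 : 0 < C by rewrite !mulr_gt0 ?expR_gt0 ?ltr0n ?fact_gt0 // exprn_gt0.
apply/cvgr0Pnorm_le => e e0; near=> n.
have h : C / e <= n%:R by near: n; exact: nbhs_infty_ger.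
have n0 : (0 < n)%N by near: n; exact: nbhs_infty_gt.
have n1 : 1 <= n%:R :> R by rewrite ler1n.
have nR : 0 < n%:R :> R by rewrite ltr0n.
rewrite ger0_norm ?mulr_ge0 ?expR_ge0 //.
set x := Num.sqrt _ / 2; have x0 : 0 <= x by rewrite /x divr_ge0 ?sqrtr_ge0.
have x2 : x ^+ 2 = n%:R `^ c / 32.
  by rewrite /x exprMn sqr_sqrtr ?divr_ge0 ?powR_ge0 // exprVn; field.
have xm : n%:R ^+ 2 / 32 ^+ m.+1 <= x ^+ (2 * m.+1).
  rewrite exprM x2 exprMn exprVn ler_pM2r ?invr_gt0 ?exprn_gt0 //.
  by rewrite -!powR_mulrn ?powR_ge0 // -powRrM ler_powR.
have hx : x ^+ (2 * m.+1) / (2 * m.+1)`!%:R <= expR x.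
  have -> : (2 * m.+1 = (2 * m.+1).-1.+1)%N by rewrite prednK // muln_gt0.
  by apply: le_trans (expR_ge1Dxn (2 * m.+1).-1 x0); rewrite lerDr.
rewrite expRD expRN mulrA ler_pdivrMr ?expR_gt0 //.
rewrite ler_pdivrMr // in h.
have f0 : 0 < (2 * m.+1)`!%:R :> R by rewrite ltr0n fact_gt0.
have h2 : n%:R ^+ 2 / 32 ^+ m.+1 / (2 * m.+1)`!%:R <= expR x.
  by apply: le_trans hx; rewrite ler_pM2r ?invr_gt0.
apply: (@le_trans _ _ (e * (n%:R ^+ 2 / 32 ^+ m.+1 / (2 * m.+1)`!%:R))); last by rewrite ler_pM2l.
rewrite !mulrA !ler_pdivlMr ?exprn_gt0 //.
have -> : n%:R * expR (1 / 2) * (2 * m.+1)`!%:R * 32 ^+ m.+1 = n%:R * C by rewrite /C !mulrA.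
by rewrite mulrC ler_pM2r // mulrC.
Unshelve. all: by end_near.
Qed.

Lemma cusum_sign_powerful (R : realType) (F G : R -> R) (K : R)
    (eps mu t dl p : nat -> R) (c : R) :
  (forall a b, a <= b -> F b - F a <= K * (b - a)) ->
  (forall x, F (- x) = 1 - F x) ->
  0 < c ->
  (\forall n \near \oo, 0 <= t n /\ 0 < dl n) ->
  (\forall n \near \oo,
     dl n <= 1 - mixture_cdf F G (eps n) (mu n) (t n)
               - mixture_cdf F G (eps n) (mu n) (- t n)) ->
  (\forall n \near \oo,
     1 - mixture_cdf F G (eps n) (mu n) (t n)
       + mixture_cdf F G (eps n) (mu n) (- t n) <= p n) ->
  (\forall n \near \oo, n%:R `^ c <= n%:R * dl n ^+ 2 / p n) ->
  asymptotically_powerful (@cusum_sign R) F G eps mu.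
Proof.
move=> FK FN c0 htd hdl hp hc d0 d1 T0 T1 P0 P1 X0 X1 iid0 iid1.
(* With the constant 8, squaring [u sqrt (2 n p) <= n dl / 2] gives exactly [n^c p <= n dl^2]. *)
pose u n : R := Num.sqrt (n%:R `^ c / 8).
pose a n : R := n%:R * expR (1 / 2 - u n / 2).
pose b n : R := 2 * expR (- (n%:R `^ c / 32)).
have acvg : a n @[n --> \oo] --> 0 by exact: cvg_mul_expRN_sqrt_powR.
have bcvg : b n @[n --> \oo] --> 0 by exact: cvg_expRN_powR.
apply: (@squeeze_cvge _ _ _ _ (fun n => (2 * (1 - a n - b n))%:E) _ (fun=> 2%:E)).
- near=> n.
  have n0 : (0 < n)%N by near: n; exact: nbhs_infty_gt.
  have [t0 dl0] : 0 <= t n /\ 0 < dl n by near: n.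
  have h1 : dl n <= 1 - mixture_cdf F G (eps n) (mu n) (t n)
               - mixture_cdf F G (eps n) (mu n) (- t n) by near: n.
  have h2 : 1 - mixture_cdf F G (eps n) (mu n) (t n)
       + mixture_cdf F G (eps n) (mu n) (- t n) <= p n by near: n.
  have h3 : n%:R `^ c <= n%:R * dl n ^+ 2 / p n by near: n.
  have nR : 0 < n%:R :> R by rewrite ltr0n.
  have nc : 0 < n%:R `^ c :> R by exact: powR_gt0.
  (* A nonpositive [p n] would make the quotient in [h3] nonpositive (the inverse of 0 being 0). *)
  have p0 : 0 < p n.
    have dl2 : 0 <= n%:R * dl n ^+ 2 by apply: mulr_ge0; [exact: ltW|exact: sqr_ge0].
    rewrite ltNge; apply/negP => p0.
    have : n%:R * dl n ^+ 2 / p n <= 0 by rewrite mulr_ge0_le0 // invr_le0.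
    by rewrite leNgt (lt_le_trans nc h3).
  apply: tv_dist_bounds.
  + move=> A _; apply: (@cusum_sign_measurable R _ (T0 n) n (fun i => X0 n i)) => i.
    exact: measurable_funPT.
  + move=> A _; apply: (@cusum_sign_measurable R _ (T1 n) n (fun i => X1 n i)) => i.
    exact: measurable_funPT.
  + exact: (cusum_sign_null_tail (u n) n0 (iid0 n) FK FN).
  + apply: (le_trans (cusum_sign_alternative_tail n0 (iid1 n) t0 dl0 h1 h2 _ (u := u n))).
      rewrite /u -sqrtrM ?divr_ge0 ?powR_ge0 //.
      have r0 : 0 <= n%:R * dl n / 2 by rewrite divr_ge0 // mulr_ge0 // ltW.
      rewrite -[leRHS](ger0_norm r0) -sqrtr_sqr.
      apply: ler_wsqrtr.
      rewrite ler_pdivlMr // in h3.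
      rewrite !exprMn exprVn.
      have -> : n%:R `^ c / 8 * (2 * n%:R * p n) = (n%:R / 4) * (n%:R `^ c * p n) by field.
      have -> : n%:R ^+ 2 * dl n ^+ 2 / 2 ^+ 2 = (n%:R / 4) * (n%:R * dl n ^+ 2) by field.
      by rewrite ler_pM2l // divr_gt0.
    rewrite lee_fin ler_pM2l // ler_expR lerN2.
    rewrite (_ : _ / (32 * p n) = n%:R * dl n ^+ 2 / p n / 32); last first.
      by field; rewrite gt_eqF.
    by rewrite ler_pM2r ?invr_gt0.
- apply: cvg_EFin; first by near=> n.
  rewrite [X in _ --> X](_ : _ = 2 * (1 - 0 - 0)); last by rewrite !subr0 mulr1.
  apply: cvgMr; apply: cvgB => //; apply: cvgB => //; exact: cvg_cst.
- exact: cvg_cst.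
Unshelve. all: by end_near.
Qed.

(** * Symmetric densities and the generalized Gaussian *)

Lemma integrable_oneDsqrV (R : realType) :
  (@lebesgue_measure R).-integrable setT (fun x : R => ((1 + x ^+ 2)^-1)%:E).
Proof.
have p0 (x : R) : 0 < 1 + x ^+ 2 by rewrite ltr_wpDr ?sqr_ge0.
have ge0 (x : R) : 0 <= (1 + x ^+ 2)^-1 by rewrite invr_ge0 ltW.
have cf : continuous (fun x : R => (1 + x ^+ 2)^-1) by exact: continuous_oneDsqrV.
have mf : measurable_fun setT (fun x : R => (1 + x ^+ 2)^-1).
  exact: continuous_measurable_fun.
apply/integrableP; split; first exact/measurable_EFinP.
under eq_integral do rewrite abse_EFin ger0_norm //.
rewrite ge0_symfun_integralT //; last by move=> x /=; rewrite sqrrN.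
by have := @integral0y_oneDsqr R; rewrite set_itvcy => ->; rewrite -EFinM ltry.
Qed.

Lemma integrable_cst_itv (R : realType) (a b c : R) :
  (@lebesgue_measure R).-integrable `]a, b] (EFin \o cst c).
Proof.
apply/integrableP; split; first exact/measurable_EFinP.
rewrite [X in (X < _)%E](_ : _ = \int[lebesgue_measure]_(x in `]a, b]) cst `|c|%:E x)%E //.
rewrite integral_cst //= lebesgue_measure_itv /=.
by case: ifP => _; rewrite ?mule0 // -EFinD -EFinM ltry.
Qed.

Section density.
Variables (R : realType) (f : R -> R).
Let mu := @lebesgue_measure R.
Hypothesis f0 : forall x, 0 <= f x.
Hypothesis fint : mu.-integrable setT (EFin \o f).

Let F x := \int[mu]_(y in `]-oo, x]) f y.

Let fint_itv (i : interval R) : mu.-integrable [set` i] (EFin \o f).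
Proof. exact: integrableS fint. Qed.

Let mf : measurable_fun setT f.
Proof. by move/integrableP : fint => [/measurable_EFinP]. Qed.

Lemma Rintegral_rayB (a b : R) : a <= b -> F b - F a = \int[mu]_(y in `]a, b]) f y.
Proof. by move=> ab; rewrite /F Rintegral_itvB // bnd_simp. Qed.

Lemma Rintegral_rayC (a : R) :
  \int[mu]_y f y - F a = \int[mu]_(y in `]a, +oo[) f y.
Proof.
rewrite /F -(@Rintegral_itvB _ f -oo%O +oo%O a) ?bnd_simp //.
by rewrite set_itvNyy.
Qed.

Lemma Rintegral_ray_lipschitz (K : R) : (forall x, f x <= K) ->
  forall a b, a <= b -> F b - F a <= K * (b - a).
Proof.
move=> fK a b ab; rewrite Rintegral_rayB //.
have intK : mu.-integrable `]a, b] (EFin \o cst K) by exact: integrable_cst_itv.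
apply: (@le_trans _ _ (\int[mu]_(y in `]a, b]) (cst K y))).
  by apply: le_Rintegral.
rewrite Rintegral_cst //= lebesgue_measure_itv /= lte_fin.
by move: ab; rewrite le_eqVlt => /predU1P[->|-> //]; rewrite ltxx subrr.
Qed.

Lemma Rintegral_ray_ge (c a b : R) : a <= b -> (forall x, a < x <= b -> c <= f x) ->
  c * (b - a) <= F b - F a.
Proof.
move=> ab fc; rewrite Rintegral_rayB //.
have intK : mu.-integrable `]a, b] (EFin \o cst c) by exact: integrable_cst_itv.
apply: (@le_trans _ _ (\int[mu]_(y in `]a, b]) (cst c y))); last first.
  by apply: le_Rintegral => // x /=; rewrite in_itv; exact: fc.
rewrite Rintegral_cst //= lebesgue_measure_itv /= lte_fin.
by move: ab; rewrite le_eqVlt => /predU1P[->|-> //]; rewrite ltxx subrr mulr0.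
Qed.

Lemma Rintegral_ray_sym : (forall x, f (- x) = f x) ->
  forall x, F (- x) = \int[mu]_y f y - F x.
Proof.
move=> fN; have pos (x : R) : 0 <= x -> F (- x) = \int[mu]_y f y - F x.
  move=> x0; rewrite Rintegral_rayC Rintegral_itv_obnd_cbnd; last exact: fint_itv.
  rewrite /F /Rintegral; congr fine; apply/esym.
  (* The reflection formula relates the half-lines ending at 0; cutting [f] off below [x >= 0] moves
     the endpoint to [x]. Negative [x] then follows by exchanging [x] and [- x]. *)
  pose g (y : R) := (f y * (x <= y)%R%:R)%:E.
  have mg : measurable_fun setT g.
    apply/measurable_EFinP; apply: measurable_funM => //.
    rewrite (_ : (fun y : R => (x <= y)%R%:R) = \1_(`[x, +oo[)) //.
    by apply/funext => y; rewrite indicE mem_setE in_itv /= andbT.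
  have g0 y : (0 <= g y)%E by rewrite lee_fin mulr_ge0.
  have := @ge0_integration_by_substitution0 R g mg g0.
  have -> : (\int[mu]_(r in `[0%R, +oo[) g r = \int[mu]_(r in `[x, +oo[) (f r)%:E)%E.
    rewrite integral_mkcond [RHS]integral_mkcond; apply: eq_integral => y _.
    rewrite !patchE !mem_setE !in_itv /= !andbT /g.
    have [xy|xy] := leP x y; first by rewrite (le_trans x0 xy) mulr1.
    by rewrite mulr0; case: ifP.
  have -> // : (\int[mu]_(r in `]-oo, 0%R]) g (- r)%R = \int[mu]_(r in `]-oo, (- x)%R]) (f r)%:E)%E.
  rewrite integral_mkcond [RHS]integral_mkcond; apply: eq_integral => y _.
  rewrite !patchE !mem_setE !in_itv /= /g lerNr fN.
  have [xy|xy] := leP y (- x); last by rewrite mulr0; case: ifP.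
  by rewrite (le_trans xy) ?oppr_le0 // mulr1.
move=> x; have [/pos //|x0] := leP 0 x.
have := pos (- x); rewrite opprK oppr_ge0 ltW // => /(_ isT) ->.
by rewrite opprB addrC subrK.
Qed.

End density.

(** For [gamma (m + 1) >= 2] the Taylor term of degree [m + 1] of the exponential dominates x^2
    outside [-1, 1], so a multiple of [1 / (1 + x^2)] is an integrable majorant. *)
Lemma integrable_expRN_powR (R : realType) (gamma theta : R) :
  0 < gamma -> 0 < theta ->
  (@lebesgue_measure R).-integrable setT
    (EFin \o (fun x : R => expR (- (theta * `|x| `^ gamma)))).
Proof.
move=> g0 t0; have [m hm] := exists_natr_mul_ge2 g0.
pose D : R := m.+1`!%:R / theta ^+ m.+1.
have f0 : 0 < m.+1`!%:R :> R by rewrite ltr0n fact_gt0.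
have tm0 : 0 < theta ^+ m.+1 by rewrite exprn_gt0.
have D0 : 0 < D by rewrite divr_gt0.
apply: (le_integrable measurableT _ _
  (integrableZl measurableT (2 + 2 * D) (@integrable_oneDsqrV R))).
  apply/measurable_EFinP; apply: measurableT_comp => //.
  apply: measurableT_comp => //; apply: measurable_funM => //.
  by apply: (measurableT_comp (measurable_powR gamma)).
move=> x _ /=; rewrite lee_fin.
have p0 : 0 < 1 + x ^+ 2 by rewrite ltr_wpDr ?sqr_ge0.
have K0 : 0 <= (2 + 2 * D) / (1 + x ^+ 2) by rewrite divr_ge0 ?ltW //; lra.
rewrite (ger0_norm K0) (ger0_norm (expR_ge0 _)) ler_pdivlMr //.
have y0 : 0 <= theta * `|x| `^ gamma by rewrite mulr_ge0 ?powR_ge0 // ltW.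
have e1 : expR (- (theta * `|x| `^ gamma)) <= 1 by rewrite -expR0 ler_expR oppr_le0.
have [x1|x1] := leP `|x| 1.
  have x2 : x ^+ 2 <= 1 by rewrite -real_normK ?num_real // expr_le1.
  apply: (@le_trans _ _ (1 * 2)); last by lra.
  by apply: ler_pM; rewrite ?expR_ge0 //; [exact: ltW|lra].
have x2 : 1 <= x ^+ 2 by rewrite -real_normK ?num_real // exprn_ege1 // ltW.
have hx : x ^+ 2 <= (`|x| `^ gamma) ^+ m.+1.
  rewrite -real_normK ?num_real // -!powR_mulrn ?powR_ge0 // -powRrM.
  by rewrite ler_powR // ltW.
have he := expR_ge1Dxn m y0.
have h2 : x ^+ 2 <= D * expR (theta * `|x| `^ gamma).
  apply: (@le_trans _ _ (D * (theta ^+ m.+1 * (`|x| `^ gamma) ^+ m.+1 / m.+1`!%:R))).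
    apply: le_trans hx _; rewrite le_eqVlt; apply/orP; left; apply/eqP.
    by rewrite /D; field; rewrite ?gt_eqF.
  rewrite ler_pM2l //; apply: le_trans he.
  by rewrite exprMn lerDr.
rewrite expRN mulrC ler_pdivrMr ?expR_gt0 //.
have eg := expR_gt0 (theta * `|x| `^ gamma); lra.
Qed.

(** * The generalized Gaussian law: mass, symmetry, tail *)

Section gen_gauss.
Variables (R : realType) (gamma : R).
Hypothesis g0 : 0 < gamma.
Let mu := @lebesgue_measure R.
Let Z := \int[mu]_y gen_gauss_kernel gamma y.

Lemma gen_gauss_kernel_le (x y : R) : `|x| <= y ->
  gen_gauss_kernel gamma y <= gen_gauss_kernel gamma x.
Proof.
move=> xy; rewrite /gen_gauss_kernel ler_expR lerN2 ler_pM2r ?invr_gt0 //.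
rewrite ge0_ler_powR ?nnegrE ?normr_ge0 //; first exact: ltW.
by rewrite (le_trans xy) // ler_norm.
Qed.

Let k0 x : 0 < gen_gauss_kernel gamma x.
Proof. exact: expR_gt0. Qed.

Lemma gen_gauss_kernel_le1 (x : R) : gen_gauss_kernel gamma x <= 1.
Proof.
rewrite /gen_gauss_kernel -expR0 ler_expR oppr_le0.
by rewrite divr_ge0 ?powR_ge0 // ltW.
Qed.

Lemma gen_gauss_kernel_integrable :
  mu.-integrable setT (EFin \o gen_gauss_kernel gamma).
Proof.
have gi : 0 < gamma^-1 by rewrite invr_gt0.
apply: eq_integrable (integrable_expRN_powR g0 gi) => // x _.
by rewrite /= /gen_gauss_kernel mulrC.
Qed.

Lemma gen_gauss_mass_gt0 : 0 < Z.
Proof.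
apply: (@lt_le_trans _ _ (gen_gauss_kernel gamma 1)); first exact: k0.
have h0 : 0 <= \int[mu]_(y in `]-oo, 0]) gen_gauss_kernel gamma y.
  by apply: Rintegral_ge0 => x _; exact: ltW.
have h1 := Rintegral_rayC gen_gauss_kernel_integrable 1.
have h2 : 0 <= \int[mu]_(y in `]1, +oo[) gen_gauss_kernel gamma y.
  by apply: Rintegral_ge0 => x _; exact: ltW.
have := @Rintegral_ray_ge _ _ gen_gauss_kernel_integrable (gen_gauss_kernel gamma 1) 0 1.
rewrite ler01 subr0 mulr1 => /(_ isT) h3.
have h4 : \int[mu]_(y in `]-oo, 1]) gen_gauss_kernel gamma y <= Z.
  by rewrite -subr_ge0 /Z /mu h1.
suff : gen_gauss_kernel gamma 1 <=
  \int[mu]_(y in `]-oo, 1]) gen_gauss_kernel gamma y -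
  \int[mu]_(y in `]-oo, 0]) gen_gauss_kernel gamma y.
  by move=> /le_trans; apply; apply: le_trans h4; rewrite gerBl.
apply: h3 => x /andP[x0 x1]; apply: gen_gauss_kernel_le.
by rewrite ger0_norm // ltW.
Qed.

Lemma gen_gauss_density_integrable :
  mu.-integrable setT (EFin \o gen_gauss_density gamma).
Proof. exact: (integrableZr measurableT Z^-1 gen_gauss_kernel_integrable). Qed.

Lemma gen_gauss_density_ge0 x : 0 <= gen_gauss_density gamma x.
Proof. by rewrite /gen_gauss_density divr_ge0 // ltW // gen_gauss_mass_gt0. Qed.

Lemma gen_gauss_density_mass : \int[mu]_y gen_gauss_density gamma y = 1.
Proof.
rewrite /gen_gauss_density RintegralZr //; last exact: gen_gauss_kernel_integrable.
by rewrite divff // gt_eqF // gen_gauss_mass_gt0.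
Qed.

Lemma gen_gauss_cdf_sym (x : R) :
  gen_gauss_cdf gamma (- x) = 1 - gen_gauss_cdf gamma x.
Proof.
rewrite -gen_gauss_density_mass.
apply: (Rintegral_ray_sym gen_gauss_density_ge0 gen_gauss_density_integrable) => y.
by rewrite /gen_gauss_density /gen_gauss_kernel normrN.
Qed.

Lemma gen_gauss_cdf_lipschitz (a b : R) : a <= b ->
  gen_gauss_cdf gamma b - gen_gauss_cdf gamma a <= Z^-1 * (b - a).
Proof.
apply: (Rintegral_ray_lipschitz gen_gauss_density_integrable) => x.
rewrite /gen_gauss_density -/mu -/Z -[leRHS]mul1r ler_pM2r ?invr_gt0 ?gen_gauss_mass_gt0 //.
exact: gen_gauss_kernel_le1.
Qed.

Lemma gen_gauss_cdf_ge (a b c : R) : a <= b ->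
  (forall x, a < x <= b -> `|x| <= c) ->
  Z^-1 * gen_gauss_kernel gamma c * (b - a) <=
  gen_gauss_cdf gamma b - gen_gauss_cdf gamma a.
Proof.
move=> ab xc; apply: (Rintegral_ray_ge gen_gauss_density_integrable ab) => x /xc h.
rewrite /gen_gauss_density -/mu -/Z mulrC ler_pM2r ?invr_gt0 ?gen_gauss_mass_gt0 //.
exact: gen_gauss_kernel_le.
Qed.

(** Split the exponent: the fraction [theta] is bounded by its value at [t], and the rest stays
    integrable. This treats every [gamma > 0] alike. *)
Lemma gen_gauss_cdf_tail (theta : R) : 0 < theta < 1 ->
  exists2 C : R, 0 < C & forall t, 0 <= t ->
    1 - gen_gauss_cdf gamma t <= C * expR (- (theta * (t `^ gamma / gamma))).
Proof.
move=> /andP[t0 t1]; have s0 : 0 < (1 - theta) / gamma by rewrite divr_gt0 // subr_gt0.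
pose h (x : R) := expR (- ((1 - theta) / gamma * `|x| `^ gamma)).
have hint := integrable_expRN_powR g0 s0; rewrite -/mu -/h in hint.
have h0 : 0 <= \int[mu]_x h x by apply: Rintegral_ge0 => x _; exact: expR_ge0.
have Z0 := gen_gauss_mass_gt0.
exists (Z^-1 * (\int[mu]_x h x + 1)).
  by rewrite mulr_gt0 ?invr_gt0 // ltr_wpDl.
move=> t tt; set c := expR _.
have c0 : 0 < c by exact: expR_gt0.
have := Rintegral_rayC gen_gauss_density_integrable t.
rewrite gen_gauss_density_mass /gen_gauss_cdf -/mu => ->.
apply: (@le_trans _ _ (\int[mu]_(y in `]t, +oo[) (Z^-1 * c * h y))).
  apply: le_Rintegral => //.
  - exact: integrableS gen_gauss_density_integrable.
  - apply: (integrableS measurableT) => //.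
    exact: (integrableZl measurableT (Z^-1 * c) hint).
  move=> x /=; rewrite in_itv /= andbT => tx.
  rewrite /gen_gauss_density -/mu -/Z mulrC -mulrA ler_pM2l ?invr_gt0 //.
  rewrite /gen_gauss_kernel /c /h -expRD ler_expR.
  have x0 : 0 <= x by rewrite (le_trans tt) // ltW.
  have hp : t `^ gamma <= x `^ gamma by rewrite ge0_ler_powR ?nnegrE // ltW.
  rewrite ger0_norm //.
  have h1 : theta * (t `^ gamma / gamma) <= theta * (x `^ gamma / gamma).
    by rewrite ler_pM2l // ler_pM2r ?invr_gt0.
  lra.
rewrite RintegralZl //; last exact: integrableS hint.
have : \int[mu]_(y in `]t, +oo[) h y <= \int[mu]_y h y.
  have := Rintegral_rayC hint t; rewrite -/mu => <-; rewrite gerBl.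
  by apply: Rintegral_ge0 => x _; exact: expR_ge0.
move=> hh; rewrite -!mulrA ler_pM2l ?invr_gt0 // mulrC ler_pM2r //.
by rewrite (le_trans hh) // lerDl.
Qed.

End gen_gauss.

(** * The sparse and dense regimes *)

Lemma powR_ltl (R : realType) (g a b : R) : 0 < g -> 0 <= a -> a < b ->
  a `^ g < b `^ g.
Proof.
move=> g0 a0 ab; apply: gt0_ltr_powR; rewrite ?nnegrE //.
exact: le_trans a0 (ltW ab).
Qed.

Lemma powR_lel (R : realType) (g a b : R) : 0 <= g -> 0 <= a -> a <= b ->
  a `^ g <= b `^ g.
Proof.
move=> g0 a0 ab; apply: ge0_ler_powR; rewrite ?nnegrE //.
exact: le_trans a0 ab.
Qed.

Lemma powRVK (R : realType) (g a : R) : g != 0 -> 0 <= a ->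
  (a `^ (1 / g)) `^ g = a.
Proof. by move=> g0 a0; rewrite -powRrM div1r mulVf ?powRr1. Qed.

Lemma powRKV (R : realType) (g a : R) : g != 0 -> 0 <= a ->
  (a `^ g) `^ (1 / g) = a.
Proof. by move=> g0 a0; rewrite -powRrM div1r mulfV ?powRr1. Qed.

(* The threshold is (gamma q log n)^(1/gamma) with q = x^gamma <= 1, and the
   excess over the signal is governed by x - r^(1/gamma). The unconstrained
   maximiser of x^gamma - 2 (x - y)^gamma is y c / (c - 1), c = 2^(1/(gamma-1)). *)
Lemma rho_star_threshold (R : realType) (gamma beta r : R) :
  0 < gamma -> 1 / 2 < beta -> beta < 1 -> 0 < r -> r < 1 ->
  rho_star gamma beta < r ->
  exists x, [/\ r `^ (1 / gamma) <= x,
    (x - r `^ (1 / gamma)) `^ gamma < 1 - beta &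
    2 * (x - r `^ (1 / gamma)) `^ gamma < x `^ gamma + 1 - 2 * beta].
Proof.
move=> g0 b0 b1 r0 r1; set y := r `^ (1 / gamma).
have p1 (g : R) : 1 `^ g = 1 by rewrite powR1.
have gn : gamma != 0 by rewrite gt_eqF.
have y0 : 0 < y by rewrite powR_gt0.
have yg : y `^ gamma = r by rewrite powRVK // ltW.
have gi : 0 < 1 / gamma by rewrite divr_gt0.
have y1 : y < 1 by rewrite -[ltRHS](p1 (1 / gamma)); apply: powR_ltl => //; exact: ltW.
have ry (e : R) : 0 <= e -> e `^ gamma < r -> e < y.
  move=> e0 er; rewrite -(powRKV gn e0); apply: powR_ltl => //; exact: powR_ge0.
clearbody y.
rewrite /rho_star; case: ifPn => [g1 hr|]; last rewrite -ltNge => g1.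
  (* For [gamma <= 1] the threshold is the signal itself, and the conditions reduce to [beta < 1]
     and [2 beta - 1 < r]. *)
  by exists y; rewrite lexx subrr powR0 // yg; split => //; lra.
have gm0 : 0 < gamma - 1 by rewrite subr_gt0.
(* At [x = 1] the second condition is twice the first. *)
have one : (1 - y) `^ gamma < 1 - beta ->
    exists x, [/\ y <= x, (x - y) `^ gamma < 1 - beta &
      2 * (x - y) `^ gamma < x `^ gamma + 1 - 2 * beta].
  by move=> h; exists 1; split => //; [exact: ltW|rewrite powR1; lra].
set c := 2 `^ (1 / (gamma - 1)).
have c1 : 1 < c.
  by rewrite -[ltLHS](p1 (1 / (gamma - 1))); apply: powR_ltl; rewrite ?divr_gt0 ?ltr1n.
have c0 : 0 < c by lra.
have cm0 : 0 < c - 1 by lra.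
have cm : c `^ (gamma - 1) = 2 by apply: powRVK => //; rewrite gt_eqF.
have powS (b : R) : 0 < b -> b `^ gamma = b `^ (gamma - 1) * b.
  move=> b00; rewrite -{1}(subrK 1 gamma) [LHS]powRD ?powRr1 ?ltW //.
  by rewrite (gt_eqF b00) implybT.
have cNg : 2 `^ (- (gamma / (gamma - 1))) = (c `^ gamma)^-1.
  by rewrite powRN /c -powRrM; congr (_ `^ _)^-1; field; rewrite gt_eqF.
rewrite cNg; clearbody c; case: ifPn => bc hr; last first.
  rewrite -leNgt in bc.
  apply: one; set e := (1 - beta) `^ (1 / gamma) in hr.
  have b2 : 0 <= 1 - beta by rewrite subr_ge0 ltW.
  have ee : e `^ gamma = 1 - beta by exact: powRVK.
  have e1 : e < 1.
    by rewrite -[ltRHS](p1 (1 / gamma)); apply: powR_ltl => //; lra.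
  clearbody e; have ey : 1 - e < y by apply: ry => //; lra.
  by rewrite -ee; apply: powR_ltl => //; lra.
pose xs := c * (y / (c - 1)).
have yc0 : 0 < y / (c - 1) by rewrite divr_gt0.
have xsy : xs - y = y / (c - 1) by rewrite /xs; field; rewrite gt_eqF.
(* If the free maximiser exceeds 1, then [1 - y < 1 / c], so
   [(1 - y)^gamma < c^(- gamma) < 1 - beta] and [x = 1] works. *)
have [x1|x1] := leP xs 1; last first.
  apply: one; apply: (@lt_trans _ _ (c `^ gamma)^-1); last by lra.
  have cV : (c^-1) `^ gamma = (c `^ gamma)^-1.
    by rewrite -powR_inv1 ?ltW // -powRrM mulN1r powRN.
  rewrite -cV; apply: powR_ltl => //; first by lra.
  rewrite -(ltr_pM2r c0) mulVf ?gt_eqF //.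
  by move: x1; rewrite /xs mulrA ltr_pdivlMr //; lra.
exists xs; rewrite xsy.
have xsg : xs `^ gamma = 2 * c * (y / (c - 1)) `^ gamma.
  by rewrite /xs powRM ?ltW // powS // cm.
have xs1 : xs `^ gamma <= 1.
  by rewrite -[leRHS](p1 gamma); apply: powR_lel => //; [exact: ltW|rewrite mulr_ge0 // ltW].
set a := (y / (c - 1)) `^ gamma in xsg *.
set w := (c - 1) `^ (gamma - 1) in hr.
have w0 : 0 < w by rewrite powR_gt0.
have aw : a * (w * (c - 1)) = r.
  by rewrite /a /w -powS // -powRM ?ltW // divfK ?gt_eqF.
(* As [xs^gamma = 2 c a], this is the second condition; together with [2 c a <= 1] it also gives
   [a < 1 - beta]. *)
have key : beta - 1 / 2 < a * (c - 1).
  by rewrite -(ltr_pM2l w0) mulrCA aw.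
have ys : y <= xs by rewrite -subr_ge0 xsy ltW.
rewrite xsg; rewrite xsg in xs1.
by split => //; lra.
Qed.

(** The null component has equal tails, which cancel; only the shifted component is left. *)
Lemma mixture_cdf_gap (R : realType) (F : R -> R) (eps mu t : R) :
  (forall x, F (- x) = 1 - F x) ->
  1 - mixture_cdf F F eps mu t - mixture_cdf F F eps mu (- t) =
  eps * (F (t + mu) - F (t - mu)).
Proof.
by move=> FN; rewrite /mixture_cdf -opprD !FN; ring.
Qed.

(** The slack is [2 eps (F (t + mu) - F t)]. Keeping the gap on the right gives [p] the form null
    tail plus [dl]. *)
Lemma mixture_cdf_mass (R : realType) (F : R -> R) (eps mu t : R) :
  (forall x, F (- x) = 1 - F x) -> (forall a b, a <= b -> F a <= F b) ->
  0 <= eps -> 0 <= mu ->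
  1 - mixture_cdf F F eps mu t + mixture_cdf F F eps mu (- t) <=
  2 * (1 - F t) + eps * (F (t + mu) - F (t - mu)).
Proof.
move=> FN Fm e0 m0; rewrite /mixture_cdf -opprD !FN.
have h : 0 <= eps * (F (t + mu) - F t).
  by rewrite mulr_ge0 // subr_ge0 Fm // lerDl.
lra.
Qed.

Lemma gen_gauss_cdf_le (R : realType) (gamma a b : R) : 0 < gamma ->
  a <= b -> gen_gauss_cdf gamma a <= gen_gauss_cdf gamma b.
Proof.
move=> g0 ab; rewrite -subr_ge0.
apply: (le_trans _ (gen_gauss_cdf_ge (c := `|a| + `|b|) g0 ab _)).
  rewrite !mulr_ge0 ?subr_ge0 ?expR_ge0 // invr_ge0.
  exact: ltW (gen_gauss_mass_gt0 g0).
move=> x /andP[ax xb]; rewrite ler_norml; apply/andP; split.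
  rewrite lerNl (le_trans _ (_ : - a <= _)) ?lerN2 ?(ltW ax) //.
  by rewrite (le_trans (ler_norm _)) // normrN lerDl.
by rewrite (le_trans xb) // (le_trans (ler_norm _)) // lerDr.
Qed.

(** At [t = 0] one has [p = 1], and [dl] is a constant [k] times n^(s - beta - 1/2), since the
    density on [-mu, mu] is at least its value at 1. Hence [n dl^2 = k^2 n^(2 (s - beta))]; half of
    the exponent absorbs [k^2]. *)
Lemma cusum_sign_powerful_dense (R : realType) (gamma beta s : R) :
  0 < gamma -> s < 1 / 2 -> beta < s ->
  asymptotically_powerful (@cusum_sign R)
    (gen_gauss_cdf gamma) (gen_gauss_cdf gamma)
    (fun n : nat => n%:R `^ (- beta)) (fun n : nat => n%:R `^ (s - 1 / 2)).
Proof.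
move=> g0 s1 bs; set F := gen_gauss_cdf gamma.
have FN := gen_gauss_cdf_sym g0; rewrite -/F in FN.
pose k := (\int[@lebesgue_measure R]_y gen_gauss_kernel gamma y)^-1 *
  gen_gauss_kernel gamma 1 * 2.
have k0 : 0 < k.
  by rewrite !mulr_gt0 ?expR_gt0 // invr_gt0 gen_gauss_mass_gt0.
have c0 : 0 < s - beta by rewrite subr_gt0.
apply: (@cusum_sign_powerful R F F _ _ _ (fun=> 0)
  (fun n => k * (n%:R `^ (- beta) * n%:R `^ (s - 1 / 2))) (fun=> 1) (s - beta)
  (@gen_gauss_cdf_lipschitz R gamma g0) FN c0).
- near=> n; split => //.
  have nR : 0 < n%:R :> R by rewrite ltr0n; near: n; exact: nbhs_infty_gt.
  by apply: mulr_gt0 => //; apply: mulr_gt0; exact: powR_gt0.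
- near=> n.
  have n0 : (0 < n)%N by near: n; exact: nbhs_infty_gt.
  have nR : 0 < n%:R :> R by rewrite ltr0n.
  have n1 : 1 <= n%:R :> R by rewrite ler1n.
  set mu := n%:R `^ (s - 1 / 2); set eps := n%:R `^ (- beta).
  have mu0 : 0 < mu by exact: powR_gt0.
  have eps0 : 0 < eps by exact: powR_gt0.
  have mu1 : mu <= 1.
    by rewrite -[leRHS](powRr0 n%:R); apply: ler_powR => //; rewrite subr_le0 ltW.
  rewrite mixture_cdf_gap // mulrCA ler_pM2l // add0r sub0r.
  have mumu : - mu <= mu by rewrite (le_trans _ (ltW mu0)) // oppr_le0 ltW.
  apply: le_trans (gen_gauss_cdf_ge (c := 1) g0 mumu _).
    by rewrite (_ : mu - - mu = 2 * mu) ?mulrA //; ring.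
  move=> x /andP[x0 x1]; rewrite ler_norml (le_trans x1) // andbT.
  by rewrite (le_trans _ (ltW x0)) // lerN2.
- near=> n; rewrite oppr0.
  by rewrite subrK.
- near=> n.
  have n0 : (0 < n)%N by near: n; exact: nbhs_infty_gt.
  have nR : 0 < n%:R :> R by rewrite ltr0n.
  have h : (k ^+ 2)^-1 <= n%:R `^ (s - beta) by near: n; exact: powR_natr_large.
  rewrite invr1 mulr1 exprMn -powRD; last by rewrite (gt_eqF nR) implybT.
  rewrite mulrCA.
  have -> : n%:R * (n%:R `^ (- beta + (s - 1 / 2))) ^+ 2 =
      n%:R `^ (s - beta) * n%:R `^ (s - beta) :> R.
    rewrite -powR_mulrn ?powR_ge0 // -powRrM -{1}(powRr1 (ltW nR)) -!powRD ?(gt_eqF nR) ?implybT //.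
    by congr (_ `^ _); lra.
  rewrite mulrA ler_peMl ?powR_ge0 //.
  by rewrite -(ler_pM2l (exprn_gt0 2 k0)) mulfV ?gt_eqF ?exprn_gt0 // in h.
Unshelve. all: by end_near.
Qed.

Lemma natr_powR_expR (R : realType) (n : nat) (a : R) : (0 < n)%N ->
  expR (a * ln n%:R) = n%:R `^ a.
Proof. by move=> n0; rewrite /powR gt_eqF // ltr0n. Qed.

Lemma sparse_scale_large (R : realType) (gamma A : R) : 0 < gamma ->
  \forall n \near \oo, A <= (gamma * ln n%:R) `^ (1 / gamma).
Proof.
move=> g0; near=> n.
have h : expR ((`|A| `^ gamma) / gamma) <= n%:R by near: n; exact: nbhs_infty_ger.
apply: (le_trans (ler_norm A)); rewrite -[leLHS](@powRKV R gamma) ?gt_eqF //.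
apply: powR_lel; [by rewrite divr_ge0 // ltW|exact: powR_ge0|].
rewrite mulrC -ler_pdivrMr //.
by rewrite -[leLHS]expRK ler_ln // posrE ?expR_gt0 // (lt_le_trans (expR_gt0 _) h).
Unshelve. all: by end_near.
Qed.

(** The reason for the sparse scale: [z] times it has kernel value exactly n^(- z^gamma). *)
Lemma sparse_scale_powR (R : realType) (gamma z : R) (n : nat) :
  0 < gamma -> 0 <= z -> (0 < n)%N ->
  (z * (gamma * ln n%:R) `^ (1 / gamma)) `^ gamma / gamma = z `^ gamma * ln n%:R.
Proof.
move=> g0 z0 n0; have l0 : 0 <= gamma * ln n%:R.
    by apply: mulr_ge0; [exact: ltW|rewrite ln_ge0 // ler1n].
by rewrite powRM ?powR_ge0 // powRVK ?gt_eqF //; field; rewrite gt_eqF.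
Qed.

(** Each of [2 T] and [D] uses up half of [n D^2]. The spare second factor [N] in the last two
    hypotheses absorbs [C] and [k]. *)
Lemma scaled_mass_le (R : realType) (n N Q k C T D l : R) :
  0 < n -> 0 < N -> 0 < Q -> 0 < k -> 0 <= T -> 0 < l -> l <= D ->
  T <= C * Q -> 4 * C <= N * k ^+ 2 -> 2 <= N * k ->
  k ^+ 2 * (N * Q * N) <= n * l ^+ 2 -> k * (N * N) <= n * l ->
  N * (2 * T + D) <= n * D ^+ 2.
Proof.
move=> n0 N0 Q0 k0 T0 l0 lD hT m1 m2 E1 E2.
have D0 : 0 < D by exact: lt_le_trans lD.
have h1 : n * l ^+ 2 <= n * D ^+ 2.
  by rewrite ler_pM2l //; apply: lerXn2r; rewrite ?nnegrE // ltW.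
have h2 : n * l <= n * D by rewrite ler_pM2l.
have h3 := ler_wpM2l (ltW N0) hT.
have h4 := ler_wpM2l (mulr_ge0 (ltW N0) (ltW Q0)) m1.
have h5 := ler_wpM2l (ltW N0) m2.
have h6 : 2 * N * D <= n * D * D by rewrite ler_pM2r //; lra.
lra.
Qed.

Lemma cusum_sign_powerful_sparse (R : realType) (gamma beta r x : R) :
  0 < gamma -> 1 / 2 < beta -> 0 < r -> r `^ (1 / gamma) <= x ->
  (x - r `^ (1 / gamma)) `^ gamma < 1 - beta ->
  2 * (x - r `^ (1 / gamma)) `^ gamma < x `^ gamma + 1 - 2 * beta ->
  asymptotically_powerful (@cusum_sign R)
    (gen_gauss_cdf gamma) (gen_gauss_cdf gamma)
    (fun n : nat => n%:R `^ (- beta))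
    (fun n : nat => (gamma * r * ln n%:R) `^ (1 / gamma)).
Proof.
move=> g0 b12 r0; set y := r `^ (1 / gamma) => yx hA hB.
have gn : gamma != 0 by rewrite gt_eqF.
have gi : 0 < 1 / gamma by rewrite divr_gt0.
have y0 : 0 < y by rewrite powR_gt0.
have x0 : 0 < x by exact: lt_le_trans yx.
have xg0 : 0 < x `^ gamma by rewrite powR_gt0.
have B0 : 0 <= (x - y) `^ gamma by exact: powR_ge0.
(* An exponent slightly above [(x - y)^gamma] makes room for an interval of length 1 just to the
   right of [t - mu]. *)
have [a [Ba a1 a2]] : exists a, [/\ (x - y) `^ gamma < a, a < 1 - beta &
    2 * a < x `^ gamma + 1 - 2 * beta].
  move: B0 hA hB; move: (_ `^ _) => B; move: (x `^ gamma) => xg B0 hA hB.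
  have [h|h] := leP (1 - beta) ((xg + 1 - 2 * beta) / 2).
    by exists ((B + (1 - beta)) / 2); split; lra.
  by exists ((B + (xg + 1 - 2 * beta) / 2) / 2); split; lra.
have a0 : 0 < a by exact: le_lt_trans Ba.
pose b := a `^ (1 / gamma).
have ba : b `^ gamma = a by rewrite /b powRVK // ltW.
have b0 : 0 <= b by exact: powR_ge0.
have xyb : x - y < b.
  rewrite -[ltLHS](powRKV gn) ?subr_ge0 //; exact: powR_ltl.
(* The second condition survives the loss of a fraction [1 - theta] of the tail exponent. *)
have [theta [th0 th1 thx]] : exists theta, [/\ 0 < theta, theta < 1 &
    2 * beta + 2 * a - 1 < theta * x `^ gamma].
  move: xg0 a2; move: (x `^ gamma) => xg xg0 a2.
  have q0 : 0 < (2 * beta + 2 * a - 1) / xg by rewrite divr_gt0 //; lra.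
  have q1 : (2 * beta + 2 * a - 1) / xg < 1 by rewrite ltr_pdivrMr //; lra.
  exists (((2 * beta + 2 * a - 1) / xg + 1) / 2); split; try lra.
  rewrite -ltr_pdivrMr //; lra.
set F := gen_gauss_cdf gamma.
have th : 0 < theta < 1 by rewrite th0.
have [C C0 hC] := gen_gauss_cdf_tail g0 th; rewrite -/F in hC.
have FN := gen_gauss_cdf_sym g0; rewrite -/F in FN.
have Fm (u v : R) : u <= v -> F u <= F v by exact: gen_gauss_cdf_le.
pose k := (\int[@lebesgue_measure R]_y gen_gauss_kernel gamma y)^-1.
have k0 : 0 < k by rewrite invr_gt0 gen_gauss_mass_gt0.
pose L (n : nat) : R := (gamma * ln n%:R) `^ (1 / gamma).
pose t n := x * L n.
pose mu (n : nat) : R := (gamma * r * ln n%:R) `^ (1 / gamma).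
pose dl n := n%:R `^ (- beta) * (F (t n + mu n) - F (t n - mu n)).
pose p n := 2 * (1 - F (t n)) + dl n.
pose q := theta * x `^ gamma.
(* Half of the smaller margin, because n^c is spent twice: as the rate and to absorb constants. *)
have [c [c0 c1 c2]] : exists c, [/\ 0 < c, 2 * beta + 2 * a - q <= 1 - 2 * c &
    beta + a <= 1 - 2 * c].
  rewrite -/q in thx; move: thx; move: q => q' thx.
  have [h|h] := leP (1 - (2 * beta + 2 * a - q')) (1 - beta - a).
    by exists ((1 - (2 * beta + 2 * a - q')) / 2); split; lra.
  by exists ((1 - beta - a) / 2); split; lra.
have muE n : (0 < n)%N -> mu n = y * L n.
  move=> n0; have l0 : 0 <= gamma * ln n%:R.
    by apply: mulr_ge0; [exact: ltW|rewrite ln_ge0 // ler1n].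
  by rewrite /mu /L /y -powRM // ?(ltW r0) //; congr (_ `^ _); ring.
have L_ge0 n : 0 <= L n by exact: powR_ge0.
(* Keep only []t - mu, t - mu + 1]]: for large [L n] it lies inside []t - mu, t + mu]] and below
   [b * L n], where the kernel is n^(- a). *)
have dl_ge : \forall n \near \oo, k * n%:R `^ (- (beta + a)) <= dl n.
  near=> n.
  have n0 : (0 < n)%N by near: n; exact: nbhs_infty_gt.
  have nR : 0 < n%:R :> R by rewrite ltr0n.
  have L1 : (b - (x - y))^-1 <= L n by near: n; exact: sparse_scale_large.
  have L2 : (2 * y)^-1 <= L n by near: n; exact: sparse_scale_large.
  have h1 : 1 <= (b - (x - y)) * L n.
    by rewrite -ler_pdivrMl ?subr_gt0 // mulr1.
  have h2 : 1 <= 2 * y * L n by rewrite -ler_pdivrMl ?mulr_gt0 // mulr1.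
  have tmu : t n - mu n = (x - y) * L n by rewrite muE // /t mulrBl.
  have tmu0 : 0 <= t n - mu n by rewrite tmu mulr_ge0 // subr_ge0.
  rewrite /dl opprD powRD; last by rewrite (gt_eqF nR) implybT.
  rewrite mulrCA ler_pM2l ?powR_gt0 //.
  have e1 : t n - mu n <= t n - mu n + 1 by rewrite lerDl.
  apply: (@le_trans _ _ (F (t n - mu n + 1) - F (t n - mu n))); last first.
    rewrite lerD2r; apply: Fm; rewrite tmu /t (muE _ n0); lra.
  apply: le_trans (gen_gauss_cdf_ge (c := b * L n) g0 e1 _).
    rewrite -/k [X in k * _ * X](_ : _ = 1) ?mulr1; last by ring.
    rewrite ler_pM2l // /gen_gauss_kernel ger0_norm ?mulr_ge0 //.
    by rewrite sparse_scale_powR // ba -mulNr natr_powR_expR.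
  move=> v /andP[v0 v1]; rewrite ger0_norm; last exact: le_trans tmu0 (ltW v0).
  apply: le_trans v1 _; rewrite tmu; lra.
have tail_le n : (0 < n)%N -> 1 - F (t n) <= C * n%:R `^ (- q).
  move=> n0; apply: le_trans (hC (t n) _) _; first by rewrite mulr_ge0 // ltW.
  by rewrite /t sparse_scale_powR // ?(ltW x0) // mulrA -mulNr natr_powR_expR.
apply: (@cusum_sign_powerful R F F _ _ _ t dl p c
  (@gen_gauss_cdf_lipschitz R gamma g0) FN c0).
- near=> n; split; first by rewrite mulr_ge0 // ltW.
  have n0 : (0 < n)%N by near: n; exact: nbhs_infty_gt.
  have nR : 0 < n%:R :> R by rewrite ltr0n.
  have h : k * n%:R `^ (- (beta + a)) <= dl n by near: n.
  by apply: lt_le_trans h; rewrite mulr_gt0 // powR_gt0.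
- by near=> n; rewrite mixture_cdf_gap.
- near=> n; apply: mixture_cdf_mass => //; exact: powR_ge0.
- near=> n.
  have n0 : (0 < n)%N by near: n; exact: nbhs_infty_gt.
  have nR : 0 < n%:R :> R by rewrite ltr0n.
  have n1 : 1 <= n%:R :> R by rewrite ler1n.
  have h : k * n%:R `^ (- (beta + a)) <= dl n by near: n.
  have m1 : 4 * C / k ^+ 2 <= n%:R `^ c by near: n; exact: powR_natr_large.
  have m2 : 2 / k <= n%:R `^ c by near: n; exact: powR_natr_large.
  have hT := tail_le n n0.
  have T0 : 0 <= 1 - F (t n).
    by rewrite -FN; apply: Rintegral_ge0 => v _; exact: gen_gauss_density_ge0.
  set l := k * _ in h; have l0 : 0 < l by rewrite mulr_gt0 // powR_gt0.
  have D0 : 0 < dl n by exact: lt_le_trans h.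
  have nD (e f : R) : n%:R `^ e * n%:R `^ f = n%:R `^ (e + f) :> R.
    by rewrite powRD // (gt_eqF nR) implybT.
  have nM (e : R) : n%:R * n%:R `^ e = n%:R `^ (1 + e) :> R.
    by rewrite -nD powRr1 // ltW.
  have E1 : k ^+ 2 * (n%:R `^ c * n%:R `^ (- q) * n%:R `^ c) <= n%:R * l ^+ 2.
    rewrite /l exprMn [leRHS]mulrCA ler_pM2l ?exprn_gt0 // [_ `^ _ ^+ 2]expr2 !nD nM.
    by apply: ler_powR => //; lra.
  have E2 : k * (n%:R `^ c * n%:R `^ c) <= n%:R * l.
    rewrite /l [leRHS]mulrCA ler_pM2l // nD nM.
    by apply: ler_powR => //; lra.
  rewrite ler_pdivrMr ?exprn_gt0 // in m1; rewrite ler_pdivrMr // in m2.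
  have N0 : 0 < n%:R `^ c :> R by exact: powR_gt0.
  have Q0 : 0 < n%:R `^ (- q) :> R by exact: powR_gt0.
  have p0 : 0 < p n by rewrite /p; lra.
  rewrite ler_pdivlMr // /p.
  exact: (@scaled_mass_le R n%:R (n%:R `^ c) (n%:R `^ (- q)) k C _ _ l).
Unshelve. all: by end_near.
Qed.

Theorem mainTheorem1 (R : realType) (gamma : R) (hgamma : 0 < gamma) :
  (* sparse regime *)
  (forall beta r : R,
     1 / 2 < beta -> beta < 1 -> 0 < r -> r < 1 ->
     rho_star gamma beta < r ->
     asymptotically_powerful (@cusum_sign R)
       (gen_gauss_cdf gamma) (gen_gauss_cdf gamma)
       (fun n : nat => n%:R `^ (- beta))
       (fun n : nat => (gamma * r * ln n%:R) `^ (1 / gamma)))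
  /\
  (* dense regime *)
  (1 / 2 <= gamma ->
   forall beta s : R,
     0 < beta -> beta < 1 / 2 -> 0 < s -> s < 1 / 2 ->
     beta < s ->
     asymptotically_powerful (@cusum_sign R)
       (gen_gauss_cdf gamma) (gen_gauss_cdf gamma)
       (fun n : nat => n%:R `^ (- beta))
       (fun n : nat => n%:R `^ (s - 1 / 2))).
Proof.
split=> [beta r b0 b1 r0 r1 hr|_ beta s _ _ _ s1 bs].
  have [x [yx hA hB]] := rho_star_threshold hgamma b0 b1 r0 r1 hr.
  exact: (cusum_sign_powerful_sparse hgamma b0 r0 yx hA hB).
exact: cusum_sign_powerful_dense.
Qed.
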